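(* Consider the following random network model. Transmitters (interferers) form a homogeneous Poisson point process $\Phi$ on $\mathbb{R}^2$ of intensity $\lambda>0$; the typical receiver is at the origin and its intended transmitter is at fixed distance $r>0$. Fix constants $P_\text{t}>0$ (transmit power), $A>0$ (path-loss intercept), $N_0>0$ (noise power), path-loss exponents $\alpha_\text{L},\alpha_\text{N}>0$, a blockage parameter $\beta>0$ with $\ell_p(x)=e^{-\beta x}$, an integer $N_\text{h}\geq 2$, antenna gains $G,g>0$ and a beamwidth $\theta\in(0,\pi]$. Let $G_0=G\cdot G$. Each interferer $i\in\Phi$ at distance $d_i$ from the origin is independently assigned: a fading power $h_i\sim\Gamma(N_\text{h},1/N_\text{h})$; an antenna gain $M_i$ equal to $GG$ with probability $p_{GG}=(\theta/\pi)^2$, $Gg$ with probability $p_{Gg}=2\frac{\theta}{\pi}\frac{\pi-\theta}{\pi}$, and $gg$ with probability $p_{gg}=(\frac{\pi-\theta}{\pi})^2$; and a path-loss exponent $\alpha_i$ equal to $\alpha_\text{L}$ (LOS) with probability $\ell_p(d_i)$ and $\alpha_\text{N}$ (NLOS) otherwise. The desired link has fading $h_0\sim\Gamma(N_\text{h},1/N_\text{h})$ and path-loss exponent $\alpha_0$ equal to $\alpha_\text{L}$ with probability $\ell_p(r)$ and $\alpha_\text{N}$ otherwise, all these random quantities being mutually independent and independent of $\Phi$. Define $$\mathrm{SINR}=\frac{P_\text{t}G_0h_0Ar^{-\alpha_0}}{N_0+\sum_{i\in\Phi}P_\text{t}M_ih_iAd_i^{-\alpha_i}},\qquad P_\text{c}(T)=\mathbb{P}[\mathrm{SINR}\geq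 T].$$ Let $a=N_\text{h}(N_\text{h}!)^{-1/N_\text{h}}$, $K_\text{L}=\frac{a r^{\alpha_\text{L}}}{P_\text{t}G_0A}$, $K_\text{N}=\frac{a r^{\alpha_\text{N}}}{P_\text{t}G_0A}$, and for $i\in\{GG,Gg,gg\}$ let $Q_{\text{L},i}=\frac{a r^{\alpha_\text{L}}M_i}{G_0}$, $Q_{\text{N},i}=\frac{a r^{\alpha_\text{N}}M_i}{G_0}$, where $M_{GG}=GG$, $M_{Gg}=Gg$, $M_{gg}=gg$. For $n\in\{1,\dots,N_\text{h}\}$ and $T>0$ define $$\kappa_\text{L}=\sum_i p_i\int_0^\infty\Big[1-\Big(1+\tfrac{nQ_{\text{L},i}T}{x^{\alpha_\text{L}}N_\text{h}}\Big)^{-N_\text{h}}\Big]\ell_p(x)\,x\,dx,\quad \kappa_\text{N}=\sum_i p_i\int_0^\infty\Big[1-\Big(1+\tfrac{nQ_{\text{L},i}T}{x^{\alpha_\text{N}}N_\text{h}}\Big)^{-N_\text{h}}\Big](1-\ell_p(x))\,x\,dx,$$ $$\xi_\text{L}=\sum_i p_i\int_0^\infty\Big[1-\Big(1+\tfrac{nQ_{\text{N},i}T}{x^{\alpha_\text{L}}N_\text{h}}\Big)^{-N_\text{h}}\Big]\ell_p(x)\,x\,dx,\quad \xi_\text{N}=\sum_i p_i\int_0^\infty\Big[1-\Big(1+\tfrac{nQ_{\text{N},i}T}{x^{\alpha_\text{N}}N_\text{h}}\Big)^{-N_\text{h}}\Big](1-\ell_p(x))\,x\,dx,$$ (sums over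 $i\in\{GG,Gg,gg\}$). Then for every $T>0$, $$P_\text{c}(T)<\sum_{n=1}^{N_\text{h}}\binom{N_\text{h}}{n}(-1)^{n+1}e^{-nK_\text{L}TN_0}e^{-2\pi\lambda(\kappa_\text{L}+\kappa_\text{N})}\ell_p(r)+\sum_{n=1}^{N_\text{h}}\binom{N_\text{h}}{n}(-1)^{n+1}e^{-nK_\text{N}TN_0}e^{-2\pi\lambda(\xi_\text{L}+\xi_\text{N})}\big(1-\ell_p(r)\big).$$
   Context: $\Gamma(k,\theta)$ denotes the gamma distribution with shape $k$ and scale $\theta$. The quantities $\kappa_\text{L},\kappa_\text{N},\xi_\text{L},\xi_\text{N}$ depend on $n$ and $T$.
   Formalization: The integrals κ_L, κ_N, ξ_L, ξ_N are assumed finite for n = 1,…,N_h (i.e. α_N > 2; for α_N ≤ 2 they are infinite, the right side is 0 and the strict inequality fails), and the fading powers h_i, almost surely nonnegative, are taken nonnegative everywhere. *)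

(* Defs.v *)
From HB Require Import structures.
From mathcomp Require Import all_boot all_order all_algebra.
From mathcomp Require Import all_classical all_reals all_analysis.
From Stdlib Require List.

Set Implicit Arguments.
Unset Strict Implicit.
Unset Printing Implicit Defensive.

Import Order.TTheory GRing.Theory Num.Theory.
Import numFieldNormedType.Exports.
Local Open Scope classical_set_scope.
Local Open Scope ring_scope.

Definition dist0 {R : realType} (p : R * R) : R := Num.sqrt (p.1 ^+ 2 + p.2 ^+ 2).

Definition leb2 {R : realType} : set (R * R) -> \bar R :=
  ((@lebesgue_measure R) \x (@lebesgue_measure R))%E.

Definition sigma_rv {d d'} {Om : measurableType d} {T : measurableType d'}
  (f : Om -> T) : set (set Om) := [set f @^-1` B | B in measurable].

Definition sigma_ev {Om : Type} (E : set Om) : set (set Om) :=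
  [set A | A = set0 \/ A = E \/ A = ~` E \/ A = setT].

Definition mutually_indep {d} {Om : measurableType d} {R : realType}
  (P : probability Om R) (I : Type) (F : I -> set (set Om)) : Prop :=
  forall (J : seq I) (A : I -> set Om), List.NoDup J ->
    (forall i, List.In i J -> F i (A i)) ->
    P (\big[setI/setT]_(i <- J) A i) = (\prod_(i <- J) P (A i))%E.

Definition bounded2 {R : realType} (B : set (R * R)) : Prop :=
  exists c : R, B `<=` [set p | `|p.1| <= c /\ `|p.2| <= c].

Definition count_pts {Om : Type} {R : realType} (X : nat -> Om -> R * R)
  (B : set (R * R)) (w : Om) : \bar R :=
  (\sum_(0 <= k <oo) ((X k w \in B)%:R)%:E)%E.

Definition is_PPP {d} {Om : measurableType d} {R : realType}
  (P : probability Om R) (lam : R) (X : nat -> Om -> R * R) : Prop :=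
  (forall k, measurable_fun setT (X k)) /\
  (forall (m : nat) (B : 'I_m -> set (R * R)) (j : 'I_m -> nat),
     (forall i, measurable (B i) /\ bounded2 (B i)) ->
     (forall i i', i != i' -> B i `&` B i' = set0) ->
     P (\big[setI/setT]_(i < m) [set w | count_pts X (B i) w = (j i)%:R%:E])
     = (\prod_(i < m)
          (let mu := lam * fine (leb2 (B i)) in
           expR (- mu) * mu ^+ (j i) / (j i)`!%:R)%R%:E)%E).

Definition gamma_pdf {R : realType} (k : nat) (theta : R) (x : R) : R :=
  if 0 < x then x ^+ k.-1 * expR (- x / theta) / ((k.-1)`!%:R * theta ^+ k)
  else 0.

Definition has_gamma_law {d} {Om : measurableType d} {R : realType}
  (P : probability Om R) (k : nat) (theta : R) (h : Om -> R) : Prop :=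
  measurable_fun setT h /\
  forall B : set R, measurable B ->
    P (h @^-1` B) = (\int[@lebesgue_measure R]_(x in B) (gamma_pdf k theta x)%:E)%E.

Definition lp {R : realType} (beta x : R) : R := expR (- (beta * x)).

(** Given the point process X (points X k), the LOS events L k are, conditionally
    on X, independent with P[L k | X] = lp beta (dist0 (X k)). *)
Definition los_marks {d} {Om : measurableType d} {R : realType}
  (P : probability Om R) (beta : R) (X : nat -> Om -> R * R)
  (L : nat -> set Om) : Prop :=
  (forall k, measurable (L k)) /\
  forall (J : seq nat) (b : nat -> bool) (E : set Om),
    List.NoDup J ->
    <<s \bigcup_k sigma_rv (X k) >> E ->
    P (E `&` \big[setI/setT]_(j <- J) (if b j then L j else ~` L j))
    = (\int[P]_(w in E)
         (\prod_(j <- J) (if b j then lp beta (dist0 (X j w))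
                          else 1 - lp beta (dist0 (X j w))))%R%:E)%E.

(** Indices of the independent components of the model. *)
Inductive src := sXL | sH0 | sL0 | sH of nat | sM of nat.

Definition intf {R : realType} (Nh : nat) (c alpha beta : R) (los : bool) : \bar R :=
  (\int[@lebesgue_measure R]_(x in [set x : R | (0 <= x)%R])
     ((1 - (1 + c / (powR x alpha * Nh%:R)) ^- Nh) *
      (if los then lp beta x else 1 - lp beta x) * x)%R%:E)%E.

Definition kap {R : realType} (Nh : nat) (G g theta q alpha beta : R) (los : bool)
  (n : nat) (T : R) : \bar R :=
  let G0 := G * G in
  let pGG := (theta / pi) ^+ 2 in
  let pGg := 2 * (theta / pi) * ((pi - theta) / pi) in
  let pgg := ((pi - theta) / pi) ^+ 2 in
  (pGG%:E * intf Nh (n%:R * (q * (G * G) / G0) * T) alpha beta los +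
   pGg%:E * intf Nh (n%:R * (q * (G * g) / G0) * T) alpha beta los +
   pgg%:E * intf Nh (n%:R * (q * (g * g) / G0) * T) alpha beta los)%E.

Definition gain {R : realType} (G g c : R) : R :=
  if c == 0 then G * G else if c == 1 then G * g else g * g.

Definition interference {Om : Type} {R : realType} (Pt A G g alphaL alphaN : R)
  (X : nat -> Om -> R * R) (L : nat -> set Om) (h Mt : nat -> Om -> R) (w : Om)
  : \bar R :=
  (\sum_(0 <= k <oo)
     (Pt * gain G g (Mt k w) * h k w * A *
      powR (dist0 (X k w)) (- (if `[< L k w >] then alphaL else alphaN)))%R%:E)%E.

Definition signal {Om : Type} {R : realType} (Pt A G r alphaL alphaN : R)
  (h0 : Om -> R) (L0 : set Om) (w : Om) : R :=
  Pt * (G * G) * h0 w * A * powR r (- (if `[< L0 w >] then alphaL else alphaN)).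

(** The event {SINR >= T}, i.e. signal >= T (N0 + interference), with SINR = 0
    when the interference is infinite. *)
Definition coverage_event {Om : Type} {R : realType}
  (Pt A N0 G g r alphaL alphaN T : R) (X : nat -> Om -> R * R) (L : nat -> set Om)
  (h Mt : nat -> Om -> R) (h0 : Om -> R) (L0 : set Om) : set Om :=
  [set w | (T%:E * (N0%:E + interference Pt A G g alphaL alphaN X L h Mt w)
            <= (signal Pt A G r alphaL alphaN h0 L0 w)%:E)%E].

(* Main.v *)
(** Conditionally on the interference [I], coverage is the event that the
    fading [h0] exceeds [c * (N0 + I)], whose probability is an Erlang tail.
    Alzer's inequality bounds this tail strictly by
    [1 - (1 - exp (- a x)) ^ Nh], with [x = c * (N0 + I)]; expanding the power
    binomially leaves a combination of the values of the Laplace transform of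
    [I] at the points [n * a * c].
    That transform is a limit of finite products over the points: integrating
    out the fading and gain marks one by one, then the line-of-sight marks,
    turns it into the Laplace functional of the Poisson process, which is
    computed on simple functions from the joint law of the counts and extended
    by monotone approximation.  Polar coordinates, obtained from the area of
    discs, identify the exponent with the integrals kappa and xi.  The final
    inequality is strict because the transform is positive, so that [I] is
    finite with positive probability. *)
Require Import Defs.
From HB Require Import structures.
From mathcomp Require Import all_boot all_order all_algebra.
From mathcomp Require Import all_classical all_reals all_analysis.
From mathcomp Require Import measurable_realfun ring lra.
Import Order.TTheory GRing.Theory Num.Theory.
Import numFieldNormedType.Exports.
Local Open Scope classical_set_scope.
Local Open Scope ring_scope.

Set Implicit Arguments.
Unset Strict Implicit.
Unset Printing Implicit Defensive.

(** * Alzer's inequality *)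

(** The Poisson hypothesis constrains only the counts in bounded sets and says nothing about the law
    of a single [X k], so the mean of a product over the first [K] points has no closed form. The
    marks are therefore integrated out at fixed [K], where only finite products occur, and the
    counts enter after [K] tends to infinity, when the sum over the points no longer depends on
    their numbering. A priori the interference may be infinite with positive probability.
    Exponentials are taken on [0, +oo] with value 0 at +oo, so the Erlang tail and its Alzer bound
    both vanish there and can be compared pointwise. The constant [a] is [Nh] times Alzer's
    [b = (Nh!)^(-1/Nh)], the factor [Nh] coming from the scale [1/Nh] of the fading. The hypothesis
    [2 <= Nh] gives [b < 1]; for [Nh = 1] one has [b = 1], and Alzer's inequality is an equality. *)

Definition erlang_tail {R : realType} (n : nat) (x : R) : R :=
  expR (- x) * \sum_(k < n) x ^+ k / k`!%:R.

Lemma is_derive_expRM {R : realType} (c x : R) :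
  is_derive x (1 : R) (fun y : R => expR (c * y)) (c * expR (c * x)).
Proof.
apply: is_derive_eq.
by rewrite /GRing.scale /= ; ring.
Qed.

Lemma is_derive_exprn {R : realType} (n : nat) (x : R) :
  is_derive x (1 : R) (fun y : R => y ^+ n) (n%:R * x ^+ n.-1).
Proof.
have := @is_deriveX R R id n x 1 1 (is_derive_id x 1).
by rewrite exprfctE /GRing.scale/= mulr1.
Qed.

(** The derivatives of consecutive terms telescope, leaving minus the gamma density of rate 1. *)
Lemma is_derive_erlang_tail {R : realType} (n : nat) (x : R) :
  is_derive x (1 : R) (erlang_tail n.+1) (- (expR (- x) * x ^+ n / n`!%:R)).
Proof.
elim: n => [|n IHn].
  have -> : erlang_tail 1 = (fun y : R => expR (- y)).
    by apply/funext => y; rewrite /erlang_tail big_ord1 expr0 fact0 divr1 mulr1.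
  apply: is_derive_eq.
  by rewrite /GRing.scale /= fact0 expr0 divr1; ring.
have -> : erlang_tail n.+2 =
    (erlang_tail n.+1 : R -> R) +
    (fun y : R => n.+1`!%:R^-1 * (expR (- y) * y ^+ n.+1)).
  apply/funext => y; rewrite /erlang_tail big_ord_recr/= mulrDr.
  by congr (_ + _); rewrite mulrA mulrC.
have dX : is_derive x 1 (fun y : R => y ^+ n.+1) (n.+1%:R * x ^+ n).
  exact: is_derive_exprn.
apply: is_derive_eq.
rewrite /GRing.scale /= factS natrM.
have h1 : n`!%:R != 0 :> R by rewrite pnatr_eq0 -lt0n fact_gt0.
have h2 : n.+1%:R != 0 :> R by rewrite pnatr_eq0.
rewrite ?exprS; field.
by rewrite h1 nat1r h2.
Qed.

Lemma erlang_tail0 {R : realType} (n : nat) : erlang_tail n.+1 (0 : R) = 1.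
Proof.
rewrite /erlang_tail oppr0 expR0 mul1r big_ord_recl/= expr0 fact0 divr1.
by rewrite big1 ?addr0// => i _; rewrite expr0n/= mul0r.
Qed.

Lemma erlang_tail_ge0 {R : realType} (n : nat) (x : R) :
  0 <= x -> 0 <= erlang_tail n x.
Proof.
move=> x0; rewrite mulr_ge0 ?expR_ge0// sumr_ge0// => i _.
by rewrite mulr_ge0 ?exprn_ge0 ?invr_ge0.
Qed.

Lemma cvg_erlang_tail {R : realType} (n : nat) :
  erlang_tail n (x : R) @[x --> +oo] --> (0 : R).
Proof.
have H (k : nat) : (fun x : R => expR (- x) * (x ^+ k / k`!%:R)) x @[x --> +oo] --> (0 : R).
  (* The majorant comes from [x^(k+1) / (k+1)! <= exp x], divided by [x * exp x]. *)
  apply: (@squeeze_cvgr _ _ _ _ (cst 0) (fun x => k.+1%:R * x^-1)).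
  - near=> x.
    have x0 : 0 < x by near: x; exact: nbhs_pinfty_gt.
    rewrite /= mulr_ge0 ?expR_ge0 ?mulr_ge0 ?invr_ge0 ?exprn_ge0 ?(ltW x0)//=.
    rewrite ler_pdivlMr//.
    have -> : expR (- x) * (x ^+ k / k`!%:R) * x =
        k.+1%:R * (expR (- x) * (x ^+ k.+1 / k.+1`!%:R)).
      rewrite factS natrM exprS; field.
      by rewrite nat1r !pnatr_eq0 -lt0n fact_gt0.
    rewrite ler_piMr// expRN ler_pdivrMl ?expR_gt0// mulr1.
    by apply: le_trans (expR_ge1Dxn k (ltW x0)); rewrite lerDr.
  - exact: cvg_cst.
  - rewrite -[X in _ --> X](mulr0 k.+1%:R).
    by apply: cvgM; [exact: cvg_cst|apply: (iffRL (gtr0_cvgV0 (f := id) _)); [exact: nbhs_pinfty_gt|exact: cvg_id]].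
elim: n => [|n IHn].
  rewrite (_ : erlang_tail 0 = cst 0); first exact: cvg_cst.
  by apply/funext => x; rewrite /erlang_tail big_ord0 mulr0.
rewrite (_ : erlang_tail n.+1 =
    erlang_tail n \+ (fun x : R => expR (- x) * (x ^+ n / n`!%:R))).
  by rewrite -[X in _ --> X](addr0 0); apply: cvgD; [exact: IHn|exact: H].
by apply/funext => x; rewrite /erlang_tail big_ord_recr/= mulrDr.
Unshelve. all: by end_near. Qed.

(* Propagates "once nonnegative, positive afterwards" from a derivative to its
   primitive vanishing at 0; Alzer's inequality is three applications of this
   principle followed by a comparison with the limit 0 at infinity. *)
Lemma strict_sign_step {R : realType} (F f : R -> R) :
  (forall x, is_derive x (1 : R) F (f x)) -> F 0 = 0 ->
  (forall c y, 0 < c -> c < y -> 0 <= f c -> 0 < f y) ->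
  forall c y, 0 < c -> c < y -> 0 <= F c -> F c < F y.
Proof.
move=> dF F0 fS c y c0 cy Fc.
have cF : continuous F.
  by move=> x; apply: differentiable_continuous; apply/derivable1_diffP; case: (dF x).
have [x + FcE] := MVT c0 (fun x _ => dF x) (continuous_subspaceT cF).
rewrite in_itv/= => /andP[x0 xc].
have fx : 0 <= f x.
  by move: Fc; rewrite -[F c]subr0 -[X in _ - X]F0 FcE subr0 pmulr_lge0.
have [z + FyE] := MVT cy (fun x _ => dF x) (continuous_subspaceT cF).
rewrite in_itv/= => /andP[cz zy].
rewrite -subr_gt0 FyE mulr_gt0// ?subr_gt0//.
by apply: fS fx => //; apply: lt_trans cz.
Qed.

(** [Q2] has the sign of [m^2 exp z - (m-1)^2], which increases with [z]. Since [Q1] and [Q] vanish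
    at 0, the sign pattern passes from [Q2] to [Q1] and from [Q1] to [Q]. *)
Lemma alzer_aux {R : realType} (m c y : R) : 0 < m -> 0 < c -> c < y ->
  0 <= expR (m * c) - expR ((m - 1) * c) - c ->
  0 < expR (m * y) - expR ((m - 1) * y) - y.
Proof.
move=> m0.
pose Q (z : R) := expR (m * z) - expR ((m - 1) * z) - z.
pose Q1 (z : R) := m * expR (m * z) - (m - 1) * expR ((m - 1) * z) - 1.
pose Q2 (z : R) := m ^+ 2 * expR (m * z) - (m - 1) ^+ 2 * expR ((m - 1) * z).
have dQ (z : R) : is_derive z (1 : R) Q (Q1 z).
  by apply: is_derive_eq; rewrite /Q1 /GRing.scale/=; ring.
have dQ1 (z : R) : is_derive z (1 : R) Q1 (Q2 z).
  by apply: is_derive_eq; rewrite /Q2 /GRing.scale/=; ring.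
have Q2E z : Q2 z = expR ((m - 1) * z) * (m ^+ 2 * expR z - (m - 1) ^+ 2).
  rewrite /Q2 (_ : m * z = (m - 1) * z + z); last by ring.
  by rewrite expRD; ring.
have Q2S a b : 0 < a -> a < b -> 0 <= Q2 a -> 0 < Q2 b.
  move=> a0 ab; rewrite !Q2E pmulr_rge0 ?expR_gt0// pmulr_rgt0 ?expR_gt0//.
  move=> /le_lt_trans; apply; rewrite ltrD2r ltr_pM2l ?exprn_gt0//.
  by rewrite ltr_expR.
have Q1S a b : 0 < a -> a < b -> 0 <= Q1 a -> 0 < Q1 b.
  move=> a0 ab Qa; apply: (le_lt_trans Qa).
  apply: (strict_sign_step dQ1) Qa => //.
  by rewrite /Q1 !mulr0 expR0; ring.
move=> c0 cy Qc; apply: (le_lt_trans Qc).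
apply: (strict_sign_step dQ) Qc => //.
by rewrite /Q !mulr0 expR0; ring.
Qed.

Lemma alzer_exponent {R : realType} (n : nat) : (0 < n)%N ->
  let b : R := n.+1`!%:R `^ (- n.+1%:R^-1) in
  [/\ 0 < b, b < 1 & b ^+ n.+1 * n.+1`!%:R = 1].
Proof.
move=> n0 b.
have f0 : 0 < n.+1`!%:R :> R by rewrite ltr0n fact_gt0.
have b0 : 0 < b by exact: powR_gt0.
have bE : b ^+ n.+1 * n.+1`!%:R = 1.
  rewrite -powR_mulrn ?(ltW b0)// -powRrM mulNr mulVf ?pnatr_eq0//.
  by rewrite powR_inv1 ?(ltW f0)// mulVf// gt_eqF.
(* If [b >= 1], then [b^(n+1) * (n+1)!] is at least [(n+1)! > 1]. *)
split=> //; rewrite ltNge; apply/negP => b1.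
have := bE; apply/eqP; rewrite gt_eqF//.
apply: (@lt_le_trans _ _ (n.+1`!%:R)).
  by rewrite ltr1n (leq_trans _ (fact_geq _)).
by rewrite ler_peMl ?(ltW f0)// exprn_ege1.
Qed.

(** The difference [F] of the two sides vanishes at 0, and its derivative has the sign of
    [Q (b * z)], which [alzer_aux] controls: once nonnegative, positive afterwards. So [F] could
    become nonnegative only by staying positive and increasing, against its behaviour at
    infinity. *)
Lemma alzer {R : realType} (n : nat) (s : R) : (0 < n)%N -> 0 < s ->
  (1 - expR (- (n.+1`!%:R `^ (- n.+1%:R^-1) * s))) ^+ n.+1 < 1 - erlang_tail n.+1 s.
Proof.
move=> n0 s0; have := alzer_exponent (R := R) n0 => /=.
set b := _ `^ _ => -[b0 b1 bE].
(* [m] solves [n * m * b = 1 - b], so that [exp (b * z - z)] is the [n]-th power of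
   [exp (- m * b * z)]. *)
pose m := (b^-1 - 1) / n%:R.
have nR0 : 0 < n%:R :> R by rewrite ltr0n.
have m0 : 0 < m by rewrite divr_gt0// subr_gt0 invf_gt1.
pose F (z : R) := (1 - expR (- b * z)) ^+ n.+1 - 1 + erlang_tail n.+1 z.
pose f (z : R) := n.+1%:R * (1 - expR (- b * z)) ^+ n * (b * expR (- b * z))
   - expR (- z) * z ^+ n / n`!%:R.
have dF (z : R) : is_derive z (1 : R) F (f z).
  have d1 := is_derive_expRM (- b) z.
  have d2 := is_derive_erlang_tail n z.
  have d3 : is_derive z 1 (fun y => (1 - expR (- b * y)) ^+ n.+1)
     (n.+1%:R * (1 - expR (- b * z)) ^+ n * (b * expR (- b * z))).
    have d4 : is_derive z 1 (fun y => 1 - expR (- b * y)) (b * expR (- b * z)).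
      by apply: is_derive_eq; rewrite /GRing.scale/=; ring.
    exact: (@is_derive1_comp R (fun u => u ^+ n.+1) _ z _ _ (is_derive_exprn _ _) d4).
  by apply: is_derive_eq; rewrite /f subr0.
have F0 : F 0 = 0.
  by rewrite /F mulr0 expR0 subrr erlang_tail0 expr0n/= sub0r addNr.
pose Q (z : R) := expR (m * z) - expR ((m - 1) * z) - z.
(* As [b^(n+1) * (n+1)! = 1], both terms of [f] take the same positive prefactor. What remains is a
   difference of [n]-th powers of nonnegative numbers, with the sign of the difference of the
   bases. *)
have fE z : f z = b ^- n * n`!%:R^-1 * expR (- (b * z)) *
    ((1 - expR (- (b * z))) ^+ n - (b * z * expR (- (m * (b * z)))) ^+ n).
  have bEn : n.+1%:R * b = b ^- n * n`!%:R^-1.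
    move: bE; rewrite factS natrM exprS => bE.
    have fn0 : n`!%:R != 0 :> R by rewrite pnatr_eq0 -lt0n fact_gt0.
    have bn0 : b ^+ n != 0 by rewrite expf_neq0// gt_eqF.
    apply: (mulIf (mulf_neq0 bn0 fn0)).
    rewrite [RHS](_ : _ = 1); last by field; rewrite fn0 bn0.
    by rewrite -[RHS]bE; ring.
  rewrite /f mulrBr !mulNr; congr (_ - _).
    by rewrite -bEn; ring.
  rewrite exprMn -expRM_natr exprMn.
  have -> : - (m * (b * z)) * n%:R = b * z - z.
    by rewrite /m; field; rewrite !gt_eqF.
  rewrite expRD [expR (- (b * z))]expRN.
  have e0 : expR (b * z) != 0 by rewrite gt_eqF// expR_gt0.
  have fn0 : n`!%:R != 0 :> R by rewrite pnatr_eq0 -lt0n fact_gt0.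
  have bn0 : b ^+ n != 0 by rewrite expf_neq0// gt_eqF.
  by field; rewrite fn0 bn0 e0.
have QE z : Q z = expR (m * z) * ((1 - expR (- z)) - z * expR (- (m * z))).
  rewrite /Q mulrBl mul1r expRD expRN.
  have e0 : expR (m * z) != 0 by rewrite gt_eqF// expR_gt0.
  rewrite [X in _ = _ * (_ - _ * X)]expRN.
  by field; rewrite !gt_eqF ?expR_gt0.
have fQ z : 0 < z -> (0 <= f z) = (0 <= Q (b * z)) /\ (0 < f z) = (0 < Q (b * z)).
  move=> z0.
  have K0 : 0 < b ^- n * n`!%:R^-1 * expR (- (b * z)).
    by rewrite !mulr_gt0 ?expR_gt0 ?invr_gt0 ?exprn_gt0// ltr0n fact_gt0.
  have bz0 : 0 < b * z by exact: mulr_gt0.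
  have u0 : 0 <= 1 - expR (- (b * z)).
    by rewrite subr_ge0 expR_le1 oppr_le0 ltW.
  have v0 : 0 <= b * z * expR (- (m * (b * z))).
    by rewrite mulr_ge0 ?expR_ge0// ltW.
  rewrite fE QE pmulr_rge0// pmulr_rgt0// pmulr_rge0 ?expR_gt0// pmulr_rgt0 ?expR_gt0//.
  by rewrite !subr_ge0 !subr_gt0 ler_pXn2r// ltr_pXn2r.
have fS c y : 0 < c -> c < y -> 0 <= f c -> 0 < f y.
  move=> c0 cy; rewrite (fQ _ c0).1 (fQ _ (lt_trans c0 cy)).2.
  by apply: alzer_aux => //; [exact: mulr_gt0|rewrite ltr_pM2l].
have FS := strict_sign_step dF F0 fS.
suff : F s < 0.
  rewrite /F mulNr => Fs; rewrite -subr_gt0. lra.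
(* If [F s >= 0], then [F] is positive at [s + 1] and increases from there on. But [F] never exceeds
   the Erlang tail, which eventually drops below [F (s + 1)]. *)
rewrite ltNge; apply/negP => Fs.
have ss : s < s + 1 by rewrite ltrDl.
have Fs1 := FS _ _ s0 ss Fs.
have d0 : 0 < F (s + 1) by exact: le_lt_trans Fs1.
have [y [sy ey]] : exists y, s + 1 < y /\ erlang_tail n.+1 y < F (s + 1).
  near (pinfty_nbhs R) => y; exists y; split.
    by near: y; apply: nbhs_pinfty_gt; exact: num_real.
  rewrite (le_lt_trans (ler_norm _))//.
  near: y; have /cvgrPdist_lt /(_ _ d0) := @cvg_erlang_tail R n.+1.
  by under eq_near do rewrite sub0r normrN.
have s10 : 0 < s + 1 by exact: lt_trans ss.
have := FS _ _ s10 sy (ltW d0).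
apply/negP; rewrite -leNgt.
apply: (le_trans _ (ltW ey)).
rewrite /F gerDr subr_le0 exprn_ile1// ?subr_ge0 ?gerBl ?expR_ge0//.
by rewrite expR_le1 mulNr oppr_le0 mulr_ge0 ?ltW// (lt_trans s10).
Unshelve. all: by end_near. Qed.

(** * Densities and the gamma law *)

Section density.
Local Open Scope ereal_scope.
Context {d} {T : measurableType d} {R : realType}.
Variables (mu m : {measure set T -> \bar R}) (f : T -> R).
Hypotheses (mf : measurable_fun setT f) (f0 : forall x, (0 <= f x)%R).
Hypothesis mE : forall B, measurable B -> m B = \int[mu]_(x in B) (f x)%:E.

Import HBNNSimple.

Lemma integral_nnsfun_density (h : {nnsfun T >-> R}) :
  \int[m]_x (h x)%:E = \int[mu]_x ((h x)%:E * (f x)%:E).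
Proof.
rewrite integralT_nnsfun sintegralE.
transitivity (\sum_(v \in range h)
    \int[mu]_x (v%:E * ((EFin \o f) \_ (h @^-1` [set v])) x)).
  apply: eq_fsbigr => v; rewrite inE => -[y _ <-].
  rewrite ge0_integralZl//.
  - by congr (_ * _); rewrite mE// integral_mkcond.
  - apply: (measurable_restrictT _ _).1 => //.
    exact/measurable_funTS/measurable_EFinP.
  - by move=> x _; rewrite patchE; case: ifPn; rewrite ?lee_fin.
  - by rewrite lee_fin.
rewrite -ge0_integral_fsum//=.
- apply: eq_integral => x _.
  rewrite -(@fsbig_widen _ _ _ _ [set h x])//=.
  + by rewrite fsbig_set1 patchE mem_set.
  + by move=> _ ->; exists x.
  + by move=> v [_ /= hxv]; rewrite patchE memNset ?mule0// => /esym.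
- move=> v; apply: measurable_funeM.
  apply: (measurable_restrictT _ _).1 => //.
  exact/measurable_funTS/measurable_EFinP.
- move=> v x _; rewrite patchE; case: ifPn => [|_]; last by rewrite mule0.
  by rewrite inE/= => <-; rewrite mule_ge0// lee_fin.
Qed.

(** Stated for arbitrary measures because it serves three times: for the gamma law, for the radial
    measure of polar coordinates, and for the line-of-sight probabilities as a density on the events
    of the points. *)
Lemma ge0_integral_density (g : T -> \bar R) :
  measurable_fun setT g -> (forall x, 0 <= g x) ->
  \int[m]_x g x = \int[mu]_x (g x * (f x)%:E).
Proof.
move=> mg g0.
pose h := nnsfun_approx measurableT mg.
have mh n : measurable_fun setT (EFin \o h n) by exact/measurable_EFinP.
have h0 n x : 0 <= (h n x)%:E by rewrite lee_fin.
have ndh x : nondecreasing_seq (fun n => (h n x)%:E).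
  by move=> a b ab; rewrite lee_fin; exact/lefP/nd_nnsfun_approx.
have hg x : (h n x)%:E @[n --> \oo] --> g x.
  by apply: cvg_nnsfun_approx.
have H1 := @cvg_monotone_convergence _ _ _ m _ measurableT _ mh (fun n x _ => h0 n x) (fun x _ => ndh x).
have H2 := @cvg_monotone_convergence _ _ _ mu _ measurableT
  (fun n x => (h n x)%:E * (f x)%:E).
rewrite (_ : \int[m]_x g x = \int[m]_x limn (fun n => (h n x)%:E)); last first.
  by apply: eq_integral => x _; apply/esym/cvg_lim => //; exact: hg.
rewrite (_ : \int[mu]_x (g x * (f x)%:E) =
    \int[mu]_x limn (fun n => (h n x)%:E * (f x)%:E)); last first.
  apply: eq_integral => x _; apply/esym/cvg_lim => //.
  by apply: cvgeZr => //; exact: hg.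
have E : (fun n => \int[m]_x (EFin \o h n) x) =
    (fun n => \int[mu]_x ((h n x)%:E * (f x)%:E)).
  by apply/funext => n; exact: integral_nnsfun_density.
rewrite E in H1; apply: (cvg_unique _ H1) => //; apply: H2 => //.
- by move=> n; apply: emeasurable_funM => //; exact/measurable_EFinP.
- by move=> n x _; rewrite mule_ge0// lee_fin.
- by move=> x _ a b ab; rewrite lee_wpmul2r ?lee_fin//; exact: ndh.
Qed.

End density.

Lemma continuous_erlang_tail {R : realType} (n : nat) : continuous (@erlang_tail R n.+1).
Proof.
move=> x; apply: differentiable_continuous; apply/derivable1_diffP.
by case: (is_derive_erlang_tail n x).
Qed.

(** The function [- erlang_tail n.+1 (u * x)] is a primitive. The rate [u] is free since the tail of
    the fading needs rate [n.+1] and its Laplace transform rate [n.+1 + t]. *)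
Lemma integral_erlang_tail {R : realType} (n : nat) (u a : R) : 0 < u -> 0 <= a ->
  (\int[lebesgue_measure]_(x in `[a, +oo[)
     (u ^+ n.+1 * x ^+ n * expR (- (u * x)) / n`!%:R)%:E)%E =
  (erlang_tail n.+1 (u * a))%:E.
Proof.
move=> u0 a0.
have dE (x : R) : is_derive x (1 : R) (fun y => - erlang_tail n.+1 (u * y))
    (u ^+ n.+1 * x ^+ n * expR (- (u * x)) / n`!%:R).
  have du : is_derive x (1 : R) (fun y => u * y) u.
    by apply: is_derive_eq; rewrite /GRing.scale/= mulr1.
  have D := is_deriveN (@is_derive1_comp R (erlang_tail n.+1) _ x _ _ (is_derive_erlang_tail n _) du).
  apply: (is_derive_eq D).
  by rewrite mulNr opprK exprMn exprS; ring.
have cE : continuous (fun y : R => - erlang_tail n.+1 (u * y)).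
  move=> x; apply: differentiable_continuous; apply/derivable1_diffP.
  by case: (dE x).
rewrite (@ge0_continuous_FTC2y _ _ (fun y => - erlang_tail n.+1 (u * y)) _ 0).
- by rewrite -EFinB sub0r opprK.
- move=> x ax; have x0 := le_trans a0 ax.
  by rewrite !mulr_ge0 ?exprn_ge0 ?expR_ge0 ?invr_ge0// ltW.
- apply: continuous_subspaceT => x.
  have cX : {for x, continuous (fun y : R => y ^+ n)} by exact: exprn_continuous.
  have cM : {for x, continuous (fun y : R => - (u * y))}.
    by apply: cvgN; apply: cvgM; [exact: cvg_cst|exact: cvg_id].
  apply: cvgM; last exact: cvg_cst.
  apply: cvgM; first by apply: cvgM; [exact: cvg_cst|exact: cX].
  by apply: (continuous_comp cM); exact: continuous_expR.
- rewrite -oppr0; apply: cvgN.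
  apply: (cvg_comp (fun y => u * y) (erlang_tail n.+1)); last exact: cvg_erlang_tail.
  by apply: gt0_cvgMry; [exact: u0|exact: cvg_id].
- by move=> x _; case: (dE x).
- by apply: cvg_at_right_filter; exact: cE.
- by move=> x _; rewrite derive1E; case: (dE x) => _ ->.
Qed.

Section gamma_law.
Context {d} {Om : measurableType d} {R : realType} (P : probability Om R).
Variables (n : nat) (h : Om -> R).
Hypothesis hG : has_gamma_law P n.+1 (n.+1%:R^-1) h.

(** At [x = 0] the density is 0 by definition, and the formula agrees there because [0 ^ n = 0] for
    [n > 0]. *)
Lemma gamma_pdf_natE (x : R) : 0 <= x -> (0 < n)%N ->
  gamma_pdf n.+1 (n.+1%:R^-1) x =
  n.+1%:R ^+ n.+1 * x ^+ n * expR (- (n.+1%:R * x)) / n`!%:R.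
Proof.
rewrite /gamma_pdf le_eqVlt => /orP[/eqP<- n0|x0 _].
  by rewrite ltxx expr0n gtn_eqF// mulr0 !mul0r.
rewrite x0 /= invrK exprVn mulNr [x * _]mulrC.
field.
by rewrite pnatr_eq0 -lt0n fact_gt0 expf_neq0//= pnatr_eq0.
Qed.

Lemma gamma_law_tail (x : R) : (0 < n)%N -> 0 <= x ->
  P [set w | x <= h w] = (erlang_tail n.+1 (n.+1%:R * x))%:E.
Proof.
move=> n0 x0; rewrite -integral_erlang_tail//.
have -> : [set w | x <= h w] = h @^-1` `[x, +oo[.
  by apply/seteqP; split => w /=; rewrite in_itv/= andbT.
rewrite (hG.2 _ (measurable_itv _)).
apply: eq_integral => y; rewrite inE/= in_itv/= andbT => xy.
by rewrite gamma_pdf_natE// (le_trans x0).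
Qed.


Lemma gamma_law_laplace (t : R) : (0 < n)%N -> 0 <= t ->
  (\int[P]_w (expR (- (t * h w)))%:E)%E = ((1 + t / n.+1%:R) ^- n.+1)%:E.
Proof.
move=> n0 t0; case: hG => mh hGE.
have mh' : @measurable_fun _ _ Om (measurableTypeR R) setT h by [].
pose X : {mfun Om >-> measurableTypeR R} :=
  @mfun_Sub _ _ Om (measurableTypeR R) h (mem_set mh').
have N0 : 0 < n.+1%:R :> R by [].
have mexp : measurable_fun setT (fun x : R => (expR (- (t * x)))%:E).
  apply/measurable_EFinP; apply: measurableT_comp => //.
  by apply: measurableT_comp => //; exact: measurable_funM.
have mpdf : measurable_fun setT (gamma_pdf n.+1 (n.+1%:R^-1 : R)).
  rewrite /gamma_pdf.
  apply: measurable_fun_ifT => //; first exact: measurable_fun_ltr.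
  apply: measurable_funM => //; apply: measurable_funM; first exact: measurable_funX.
  apply: measurableT_comp => //; apply: measurable_funM => //.
transitivity (\int[distribution P X]_x (expR (- (t * x)))%:E)%E.
  by rewrite ge0_integral_distribution// => x; rewrite lee_fin expR_ge0.
have pdf0 (x : R) : 0 <= gamma_pdf n.+1 (n.+1%:R^-1) x.
  rewrite /gamma_pdf; case: ifPn => // x0.
  by rewrite !mulr_ge0 ?exprn_ge0 ?expR_ge0 ?invr_ge0 ?mulr_ge0 ?exprn_ge0// ?invr_ge0 ltW.
have exp0 (x : R) : (0 <= (expR (- (t * x)))%:E)%E by rewrite lee_fin expR_ge0.
have E := @ge0_integral_density _ _ _ (@lebesgue_measure R) (distribution P X)
  _ mpdf pdf0 hGE _ mexp exp0.
rewrite {}E.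
(* Exponential tilting: the factor [exp (- t x)] turns the gamma density of rate [n.+1] into the one
   of rate [n.+1 + t], up to the constant [((n+1) / (n+1+t))^(n+1)]. *)
transitivity (\int[lebesgue_measure]_(x in `[0%R, +oo[)
     (((n.+1%:R / (n.+1%:R + t)) ^+ n.+1)%:E *
     ((n.+1%:R + t) ^+ n.+1 * x ^+ n * expR (- ((n.+1%:R + t) * x)) / n`!%:R)%:E))%E.
    rewrite [RHS]integral_mkcond; apply: eq_integral => x _; rewrite patchE.
    case: ifPn; rewrite ?inE ?notin_setE/= in_itv/= andbT.
      move=> x0; rewrite gamma_pdf_natE// -!EFinM; congr (_%:E).
      rewrite mulrDl opprD expRD exprMn exprVn; field.
      by rewrite pnatr_eq0 -lt0n fact_gt0 expf_neq0// gt_eqF// ltr_pwDl.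
    by move=> /negP; rewrite -ltNge /gamma_pdf => x0; rewrite ltNge (ltW x0)/= mule0.
  rewrite ge0_integralZl//.
  + rewrite integral_erlang_tail// ?ltr_pwDl// mulr0 erlang_tail0 mule1.
    congr (_%:E); rewrite -exprVn; congr (_ ^+ _).
    by field; rewrite !nat1r !gt_eqF// ltr_pwDl.
  + have mR : measurable_fun setT (fun x : R =>
        (n.+1%:R + t) ^+ n.+1 * x ^+ n * expR (- ((n.+1%:R + t) * x)) / n`!%:R).
      apply: measurable_funM => //; apply: measurable_funM.
        by apply: measurable_funM => //; exact: measurable_funX.
      apply: measurableT_comp => //; apply: measurableT_comp => //.
    by apply/measurable_EFinP; apply: measurable_funTS; exact: mR.
  + move=> x; rewrite /= in_itv/= andbT => x0; rewrite lee_fin.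
    by rewrite !mulr_ge0 ?exprn_ge0 ?expR_ge0 ?invr_ge0// addr_ge0.
  + by rewrite lee_fin exprn_ge0// divr_ge0// addr_ge0.
Qed.

End gamma_law.

(** * Independence and Fubini *)

Lemma big_setI_In {Om I : Type} (J : seq I) (A : I -> set Om) :
  \big[setI/setT]_(i <- J) A i = [set w | forall i, List.In i J -> A i w].
Proof.
elim: J => [|i J IHJ]; first by rewrite big_nil; apply/seteqP; split => // w _ i [].
rewrite big_cons IHJ; apply/seteqP; split => w.
  move=> [Ai AJ] j /= ijJ; case: ijJ => [<- //|jJ].
  exact: AJ.
move=> AJ; split; first by apply: AJ; left.
by move=> j jJ; apply: AJ; right.
Qed.

Lemma eq_big_In {V I : Type} (x : V) (op : V -> V -> V) (J : seq I) (F G : I -> V) :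
  (forall i, List.In i J -> F i = G i) ->
  \big[op/x]_(i <- J) F i = \big[op/x]_(i <- J) G i.
Proof.
elim: J => [|i J IHJ] FG; first by rewrite !big_nil.
rewrite !big_cons FG; last by left.
by rewrite IHJ// => j jJ; apply: FG; right.
Qed.

(** Finite intersections of events of the sources other than [i] form a pi-system, on which
    independence from [A] is the hypothesis; uniqueness of finite measures extends it to the
    generated sigma-algebra. *)
Lemma mutually_indep_others {d} {Om : measurableType d} {R : realType}
    (P : probability Om R) (I : Type) (F : I -> set (set Om)) :
  (forall i, F i `<=` measurable) -> (forall i, setI_closed (F i)) ->
  (forall i, F i setT) -> mutually_indep P F ->
  forall i A B, F i A -> <<s \bigcup_(j in [set j | j <> i]) F j >> B ->
  P (A `&` B) = (P A * P B)%E.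
Proof.
move=> Fm FI FT PF i A B FA sB.
pose G := [set B | exists (J : seq I) (Bs : I -> set Om),
  [/\ List.NoDup J, ~ List.In i J, forall j, List.In j J -> F j (Bs j) &
     B = \big[setI/setT]_(j <- J) Bs j]].
have sGB : <<s G >> B.
  apply: sub_sigma_algebra2 sB => C [j /= ji FC].
  exists [:: j], (fun _ => C); split.
  - by apply: List.NoDup_cons => //; exact: List.NoDup_nil.
  - by case.
  - by move=> k [<-|].
  - by rewrite big_seq1.
have Gm : G `<=` measurable.
  move=> _ [J [Bs [_ _ FJ ->]]].
  elim: J FJ => [|j J IHJ] FJ; first by rewrite big_nil.
  rewrite big_cons; apply: measurableI; first by apply/(Fm j)/FJ; left.
  by apply: IHJ => k kJ; apply: FJ; right.
have GT : G setT.
  exists [::], (fun _ => setT); split => //; first exact: List.NoDup_nil.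
  by rewrite big_nil.
have GI : setI_closed G.
  move=> _ _ [J1 [B1 [_ iJ1 F1 ->]]] [J2 [B2 [_ iJ2 F2 ->]]].
  (* Padding with the full set lets two intersections over different index lists be read over the
     merged list. *)
  pose B1' j := if pselect (List.In j J1) then B1 j else setT.
  pose B2' j := if pselect (List.In j J2) then B2 j else setT.
  pose J := List.nodup (fun x y => pselect (x = y)) (List.app J1 J2).
  have inJ j : List.In j J <-> (List.In j J1 \/ List.In j J2).
    by rewrite List.nodup_In List.in_app_iff.
  exists J, (fun j => B1' j `&` B2' j); split.
  - exact: List.NoDup_nodup.
  - by move=> /inJ[].
  - move=> j _; apply: FI.
      by rewrite /B1'; case: pselect => // jJ; exact: F1.
    by rewrite /B2'; case: pselect => // jJ; exact: F2.
  - rewrite !big_setI_In; apply/seteqP; split => [w [w1 w2] j _|w Hw].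
      split; first by rewrite /B1'; case: pselect => // jJ; exact: w1.
      by rewrite /B2'; case: pselect => // jJ; exact: w2.
    split => j jJ.
      have /Hw[+ _] : List.In j J by apply/inJ; left.
      by rewrite /B1'; case: pselect.
    have /Hw[_ +] : List.In j J by apply/inJ; right.
    by rewrite /B2'; case: pselect.
have mA : measurable A by exact: (Fm i).
have PA0 : 0 <= fine (P A) by exact: fine_ge0.
have PAE : (fine (P A))%:E = P A by rewrite fineK// fin_num_measure.
have mE E : mscale (NngNum PA0) P E = (P A * P E)%E by rewrite /mscale/= PAE.
(* Both sides are finite measures in [B]: [P] restricted to [A], and [P] scaled by [P A]. *)
rewrite setIC -mE -[LHS]/(mrestr P mA B).
apply: (@g_sigma_algebra_measure_unique _ R Om G Gm (fun _ => setT)) => //.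
- by rewrite bigcup_const//; exists 0%N.
- move=> _ [J [Bs [uJ iJ FJ ->]]]; apply: etrans (esym (mE _)); rewrite /= /mrestr.
  pose As k := if pselect (k = i) then A else Bs k.
  have AsJ k : List.In k J -> As k = Bs k.
    by move=> kJ; rewrite /As; case: pselect => // ki; case: iJ; rewrite -ki.
  have Asi : As i = A by rewrite /As; case: pselect.
  have := PF (i :: J) As (List.NoDup_cons _ iJ uJ).
  rewrite !big_cons Asi (eq_big_In _ _ AsJ).
  rewrite (@eq_big_In _ _ _ _ _ _ (fun k => P (Bs k))); last by move=> k /AsJ ->.
  rewrite -(PF J Bs uJ FJ) setIC; apply.
  by move=> k [<-|kJ]; rewrite ?Asi// AsJ//; exact: FJ.
- by move=> _; rewrite /= /mrestr setTI -PAE ltry.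
Qed.

(** Independence on rectangles identifies the joint law of [(U, V)] with the product of the marginal
    laws, and Tonelli applies on the target spaces. *)
Lemma indep_fubini {d d1 d2} {Om : measurableType d} {T1 : measurableType d1}
    {T2 : measurableType d2} {R : realType} (P : probability Om R)
    (U : Om -> T1) (V : Om -> T2) (f : T1 * T2 -> \bar R) :
  measurable_fun setT U -> measurable_fun setT V ->
  (forall A B, measurable A -> measurable B ->
     P (U @^-1` A `&` V @^-1` B) = (P (U @^-1` A) * P (V @^-1` B))%E) ->
  measurable_fun [set: T1 * T2] f -> (forall x, 0 <= f x)%E ->
  (\int[P]_w f (U w, V w) = \int[P]_w \int[P]_w' f (U w', V w))%E.
Proof.
move=> mU mV UV mf f0.
pose X : {mfun Om >-> T1} := mfun_Sub (mem_set mU).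
pose Y : {mfun Om >-> T2} := mfun_Sub (mem_set mV).
have mXY : measurable_fun setT (fun w => (U w, V w)) by exact: measurable_fun_pair.
pose XY : {mfun Om >-> (T1 * T2)%type} := mfun_Sub (mem_set mXY).
have E := @product_measure_unique _ _ T1 T2 R (distribution P X) (distribution P Y)
  (distribution P XY) UV.
transitivity (\int[distribution P XY]_z f z)%E.
  by rewrite ge0_integral_distribution.
rewrite -(eq_measure_integral _ (fun A mA _ => E A mA)).
rewrite fubini_tonelli2//= /fubini_G.
rewrite ge0_integral_distribution//=.
- apply: eq_integral => w _ /=.
  rewrite ge0_integral_distribution//; exact: measurableT_comp mf (measurable_pair2 _).
- exact: measurable_fun_fubini_tonelli_G.
- by move=> y; apply: integral_ge0.
Qed.

(** * Polar coordinates *)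

Lemma measurable_dist0 {R : realType} : measurable_fun setT (@dist0 R).
Proof.
apply: (measurableT_comp (continuous_measurable_fun (@sqrt_continuous R))).
by apply: measurable_funD; apply: measurable_funX; [exact: measurable_fst|exact: measurable_snd].
Qed.

Lemma dist0_ge0 {R : realType} (p : R * R) : 0 <= dist0 p.
Proof. exact: sqrtr_ge0. Qed.

(** For [c <= 0] both sides are false because [Num.sqrt] is 0 there. This treats vertical lines that
    miss a disc like those that meet it. *)
Lemma ltr_sqr_sqrt {R : realType} (y c : R) : (y ^+ 2 < c) = (`|y| < Num.sqrt c).
Proof.
have [c0|c0] := ltP 0 c; first by rewrite -sqrtr_sqr ltr_sqrt.
rewrite (ler0_sqrtr c0) [RHS]ltNge normr_ge0/=.
by apply/negbTE; rewrite -leNgt (le_trans c0)// sqr_ge0.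
Qed.

(** The integrand is the length of the chord of the disc at abscissa [x]. Under [x = rho * sin t]
    the integral becomes that of [2 * rho^2 * cos^2 t], with primitive
    [rho^2 * (t + sin t * cos t)]. *)
Lemma integral_half_chord {R : realType} (rho : R) : 0 < rho ->
  (\int[lebesgue_measure]_(x in `[(- rho)%R, rho]) (2 * Num.sqrt (rho ^+ 2 - x ^+ 2))%:E)%E
  = (pi * rho ^+ 2)%:E.
Proof.
move=> rho0.
pose F (t : R) := rho * sin t.
pose G (x : R) := 2 * Num.sqrt (rho ^+ 2 - x ^+ 2).
have pi2 : - (pi / 2) <= pi / 2 :> R by have := @pi_gt0 R; lra.
have pi2' : - (pi / 2) < pi / 2 :> R.
  by have := @pi_gt0 R; lra.
have dF (t : R) : is_derive t (1 : R) F (rho * cos t).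
  by apply: is_derive_eq; rewrite /GRing.scale/=; ring.
have F'E : derive1 F = (fun t => rho * cos t).
  by apply/funext => t; rewrite derive1E; case: (dF t) => _ ->.
have cF : continuous F.
  by move=> t; apply: differentiable_continuous; apply/derivable1_diffP; case: (dF t).
have cF' : continuous (fun t : R => rho * cos t).
  by move=> t; apply: cvgM; [exact: cvg_cst|exact: continuous_cos].
have FL : F (- (pi / 2)) = - rho by rewrite /F sinN sin_pihalf mulrN1.
have FR : F (pi / 2) = rho by rewrite /F sin_pihalf mulr1.
have := @integration_by_substitution_increasing R F G _ _ pi2.
rewrite FL FR => ->; last first.
- apply: continuous_subspaceT => x; apply: cvgM; first exact: cvg_cst.
  apply: (@continuous_comp _ _ _ (fun x : R => rho ^+ 2 - x ^+ 2) Num.sqrt); last exact: sqrt_continuous.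
  by apply: cvgB; [exact: cvg_cst|exact: exprn_continuous].
- split=> [x _||]; first by case: (dF x).
  + by apply: cvg_at_right_filter; exact: cF.
  + by apply: cvg_at_left_filter; exact: cF.
- by rewrite F'E; apply/cvg_ex; eexists; apply: cvg_at_left_filter; exact: cF'.
- by rewrite F'E; apply/cvg_ex; eexists; apply: cvg_at_right_filter; exact: cF'.
- by rewrite F'E => x _; exact: cF'.
- by move=> x y xI yI xy; rewrite /F ltr_pM2l// ltr_sin.
pose H (t : R) := rho ^+ 2 * (t + sin t * cos t).
transitivity (\int[lebesgue_measure]_(t in `[(- (pi / 2))%R, (pi / 2)%R])
    (2 * rho ^+ 2 * cos t ^+ 2)%:E)%E.
  apply: eq_integral => t; rewrite inE/= in_itv/= => tI; rewrite F'E mulrfctE/= /G /F.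
  congr (_%:E).
  have -> : rho ^+ 2 - (rho * sin t) ^+ 2 = (rho * cos t) ^+ 2.
    by rewrite !exprMn -[RHS]mulr1 -[cos t ^+ 2](addrK (sin t ^+ 2)) cos2Dsin2; ring.
  rewrite sqrtr_sqr ger0_norm; first by ring.
  by rewrite mulr_ge0 ?(ltW rho0)// cos_ge0_pihalf.
have dH (t : R) : is_derive t (1 : R) H (2 * rho ^+ 2 * cos t ^+ 2).
  apply: is_derive_eq; rewrite /GRing.scale/=.
  by rewrite -[X in _ * (X + _)](cos2Dsin2 t); ring.
rewrite (@continuous_FTC2 _ _ H)//.
- rewrite -EFinB /H; congr (_%:E).
  by rewrite cosN cos_pihalf !mulr0 !addr0; field.
- apply: continuous_subspaceT => t; apply: cvgM; first exact: cvg_cst.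
  have := @continuous_cos R t => ct.
  by apply: cvgM; exact: ct.
- split=> [x _||]; first by case: (dH x).
  + apply: cvg_at_right_filter; apply: differentiable_continuous.
    by apply/derivable1_diffP; case: (dH (- (pi / 2))).
  + apply: cvg_at_left_filter; apply: differentiable_continuous.
    by apply/derivable1_diffP; case: (dH (pi / 2)).
- by move=> t _; rewrite derive1E; case: (dH t) => _ ->.
Qed.

(** Provides the pushforward as a bundled measure known only by its values, so that the
    measurability proof does not appear in the goals. *)
Lemma pushforward_measure_ex {d d'} {T : measurableType d} {T' : measurableType d'}
    {R : realType} (mu : {measure set T -> \bar R}) (f : T -> T') :
  measurable_fun setT f ->
  exists m : {measure set T' -> \bar R}, forall A, m A = mu (f @^-1` A).
Proof. by move=> mf; exists (pushforward mu f). Unshelve. exact: mf. Qed.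

Section polar.
Context {R : realType}.
Notation mR := (measurableTypeR R).
Notation leb := (@lebesgue_measure R).

Let mdist : @measurable_fun _ _ (mR * mR)%type mR setT (@dist0 R).
Proof. exact: measurable_dist0. Qed.

(** Cavalieri's principle: the section at [x] is an open interval as long as the chord, and it is
    empty for [|x| >= rho], where the square root is 0. *)
Lemma disc_area (rho : R) : 0 < rho ->
  (leb \x leb)%E [set p | dist0 p < rho] = (pi * rho ^+ 2)%:E.
Proof.
move=> rho0; rewrite /product_measure1.
rewrite -(integral_half_chord rho0) [RHS]integral_mkcond.
apply: eq_integral => x _ /=.
have E (y : R) : (dist0 (x : R, y) < rho) = (y ^+ 2 < rho ^+ 2 - x ^+ 2).
  by rewrite ltrBrDl -[RHS]ltr_sqrt ?exprn_gt0// sqrtr_sqr gtr0_norm.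
have -> : xsection [set p | dist0 p < rho] x =
    `](- Num.sqrt (rho ^+ 2 - x ^+ 2)), (Num.sqrt (rho ^+ 2 - x ^+ 2))[%classic.
  apply/seteqP; split => y; rewrite /xsection/= inE/= in_itv/= -ltr_norml -ltr_sqr_sqrt;
    by rewrite -E.
rewrite patchE; case: ifPn => [xI|]; last first.
  rewrite notin_setE/= in_itv/= -ler_norml => /negP; rewrite -ltNge => rx.
  rewrite lebesgue_measure_itv/= ler0_sqrtr ?oppr0 ?ltxx//.
  by rewrite subr_le0 -(real_normK (num_real x)) ler_pXn2r ?nnegrE// ltW.
rewrite lebesgue_measure_itv/= lte_fin.
have s0 := sqrtr_ge0 (rho ^+ 2 - x ^+ 2).
case: ifPn => [_|]; first by rewrite -EFinB; congr (_%:E); ring.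
rewrite -leNgt => s1; have -> : Num.sqrt (rho ^+ 2 - x ^+ 2) = 0 by lra.
by rewrite mulr0.
Qed.

Let rmax (x : R) : R := 2 * pi * Num.max 0 x.

Let rmax_ge0 (x : R) : 0 <= rmax x.
Proof. by rewrite mulr_ge0 ?le_max ?lexx// mulr_ge0// pi_ge0. Qed.

Let measurable_rmax : measurable_fun setT rmax.
Proof. by apply: measurable_funM => //; exact: measurable_maxr. Qed.

Let measurable_rmax' : @measurable_fun _ _ mR R setT rmax.
Proof. exact: measurable_rmax. Qed.

(** The density [2 * pi * x] is the derivative of the disc area [pi * x^2]. It is extended by 0 to
    negative [x] so that the measure lives on the whole line, like the pushforward of the planar
    measure by [dist0]. *)
Definition radial_measure (B : set mR) : \bar R :=
  (\int[leb]_(x in B) (rmax x)%:E)%E.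

Let radial0 : radial_measure set0 = 0%E.
Proof. by rewrite /radial_measure integral_set0. Qed.

Let radial_ge0 B : (0 <= radial_measure B)%E.
Proof. by apply: integral_ge0 => x _; rewrite lee_fin rmax_ge0. Qed.

Let radial_sigma_additive : semi_sigma_additive radial_measure.
Proof.
move=> /= F mF tF mUF; rewrite /radial_measure; apply: cvg_toP.
  apply: ereal_nondecreasing_is_cvgn => m n mn.
  apply: lee_sum_nneg_natr => // k _ _.
  by apply: integral_ge0 => /= x Fkx; rewrite lee_fin rmax_ge0.
rewrite ge0_integral_bigcup//=.
- by apply/measurable_EFinP; apply: measurable_funTS.
- by move=> x _; rewrite lee_fin rmax_ge0.
Qed.

HB.instance Definition _ := isMeasure.Build _ _ _ radial_measure
  radial0 radial_ge0 radial_sigma_additive.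

Lemma radial_measure_itv (rho : R) : 0 <= rho ->
  radial_measure `]-oo, rho[ = (pi * rho ^+ 2)%:E.
Proof.
move=> rho0; rewrite /radial_measure.
transitivity (\int[leb]_(x in `[0%R, rho]) (2 * pi * x)%:E)%E.
  rewrite -integral_itv_bndo_bndc; last first.
    by apply/measurable_EFinP; apply: measurable_funTS; exact: mulrl_measurable.
  rewrite integral_mkcond [RHS]integral_mkcond; apply: eq_integral => x _.
  rewrite !patchE; case: ifPn; rewrite ?inE ?notin_setE/= in_itv/= => xr.
    case: ifPn; rewrite ?inE ?notin_setE/= in_itv/= xr andbT.
      by move=> x0; rewrite /rmax max_r.
    by move=> /negP; rewrite -ltNge => x0; rewrite /rmax max_l ?mulr0// ltW.
  by rewrite memNset//= in_itv/= => /andP[_ /xr].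
move: rho0; rewrite le_eqVlt => /predU1P[<-|rho0].
  by rewrite set_itv1 integral_set1 expr0n mulr0.
have dX (x : R) : is_derive x (1 : R) (fun x => pi * x ^+ 2) (2 * pi * x).
  have d2 := is_derive_exprn 2 x.
  by apply: is_derive_eq; rewrite /GRing.scale/=; ring.
have cX : continuous (fun x : R => pi * x ^+ 2).
  by move=> x; apply: cvgM; [exact: cvg_cst|exact: exprn_continuous].
rewrite (@continuous_FTC2 _ _ (fun x => pi * x ^+ 2))//.
- by rewrite expr0n/= mulr0 sube0.
- by apply: continuous_subspaceT => x; exact: mulrl_continuous.
- split=> [x _||]; first by case: (dX x).
  + by apply: cvg_at_right_filter; exact: cX.
  + by apply: cvg_at_left_filter; exact: cX.
- by move=> x _; rewrite derive1E; case: (dX x) => _ ->.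
Qed.

(** Both measures agree on the half-lines []-oo, rho[], where they give the area of a disc. These
    form a generating pi-system, and those with natural endpoints exhaust the line with finite
    mass. *)
Lemma dist0_pushforward (B : set mR) : measurable B ->
  (leb \x leb)%E (@dist0 R @^-1` B) = radial_measure B.
Proof.
have [m mE] := pushforward_measure_ex (leb \x leb)%E mdist.
rewrite -mE => mB.
apply: (@measure_unique _ R mR (@RGenInftyO.G R) (fun n => `]-oo, n%:R[%classic)
  _ _ _ _ m radial_measure) => //.
- exact: RGenInftyO.measurableE.
- move=> _ _ [x ->] [y ->]; exists (Num.min x y).
  apply/seteqP; split => z; rewrite /= !in_itv/= lt_min.
    by move=> [-> ->].
  by move=> /andP[].
- by move=> n; exists n%:R.
- apply/seteqP; split => // x _.
  exists (Num.truncn x).+1 => //=; rewrite in_itv/=.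
  exact: truncnS_gt.
- move=> _ [rho ->]; rewrite mE.
  have [rho0|rho0] := leP rho 0.
    transitivity (0 : \bar R)%E.
      rewrite (_ : _ @^-1` _ = set0) ?measure0//.
      apply/seteqP; split => // p /=; rewrite in_itv/=.
      by rewrite ltNge (le_trans rho0 (dist0_ge0 p)).
    rewrite /= /radial_measure integral0_eq// => x; rewrite /= in_itv/= => xr.
    by rewrite /rmax max_l ?mulr0// ltW// (lt_le_trans xr).
  rewrite (_ : _ @^-1` _ = [set p | dist0 p < rho]).
    by apply: (etrans (disc_area rho0)); apply/esym/radial_measure_itv/ltW.
  by apply/seteqP; split => p /=; rewrite in_itv.
- move=> n; rewrite mE (_ : _ @^-1` _ = [set p | dist0 p < n%:R]); last first.
    by apply/seteqP; split => p /=; rewrite in_itv.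
  case: n => [|n]; last first.
    by apply: le_lt_trans (ltry (pi * n.+1%:R ^+ 2)); rewrite le_eqVlt; apply/orP; left; apply/eqP; exact: (disc_area (ltr0Sn _ n)).
  rewrite (_ : [set _ | _] = set0) ?measure0//.
  by apply/seteqP; split => // p /=; rewrite ltNge dist0_ge0.
Qed.

Lemma integral_dist0 (g : R -> \bar R) : measurable_fun setT g ->
  (forall x, 0 <= g x)%E ->
  (\int[leb \x leb]_p g (dist0 p) =
   \int[leb]_(x in [set x : R | (0 <= x)%R]) (g x * (2 * pi * x)%:E))%E.
Proof.
move=> mg g0.
have mg' : @measurable_fun _ _ mR _ setT g by exact: mg.
have := @ge0_integral_pushforward _ _ _ _ _ _ mdist (leb \x leb)%E setT g measurableT mg'.
rewrite preimage_setT => <- //.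
have [m mE] := pushforward_measure_ex (leb \x leb)%E mdist.
transitivity (\int[m]_x g x)%E.
  by apply: eq_measure_integral => A mA _; rewrite mE.
transitivity (\int[radial_measure]_x g x)%E.
  by apply: eq_measure_integral => A mA _; rewrite mE; exact: dist0_pushforward.
rewrite (@ge0_integral_density _ _ _ leb _ _ measurable_rmax')//.
rewrite [RHS]integral_mkcond; apply: eq_integral => x _; rewrite patchE.
case: ifPn; rewrite ?inE ?notin_setE/= => x0; first by rewrite /rmax max_r.
by rewrite /rmax max_l ?mulr0 ?mule0// leNgt; apply/negP => /ltW.
Qed.

End polar.

(** * Laplace functional of the Poisson process *)

(* [exp (- y)] for [y] in [0, +oo]; the value at [-oo] is a junk [0]. *)
Definition expN {R : realType} (y : \bar R) : R :=
  if y is r%:E then expR (- r) else 0.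

Section expN_theory.
Context {R : realType}.
Implicit Types x y : \bar R.

Lemma expN0 : expN (0 : \bar R)%E = 1.
Proof. by rewrite /= oppr0 expR0. Qed.

Lemma expN_ge0 y : 0 <= expN y.
Proof. by case: y => //= r; rewrite expR_ge0. Qed.

Lemma expN_le1 y : (0 <= y)%E -> expN y <= 1.
Proof. by case: y => //= r; rewrite lee_fin expR_le1 oppr_le0. Qed.

Lemma expND x y : (0 <= x)%E -> (0 <= y)%E -> expN (x + y)%E = expN x * expN y.
Proof.
case: x => [r| |]//; case: y => [s| |]//= _ _; rewrite ?mulr0 ?mul0r//.
by rewrite opprD expRD.
Qed.

Lemma expN_sum (I : Type) (s : seq I) (f : I -> \bar R) :
  (forall i, 0 <= f i)%E -> expN (\sum_(i <- s) f i)%E = \prod_(i <- s) expN (f i).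
Proof.
move=> f0; elim: s => [|i s IHs]; first by rewrite !big_nil expN0.
by rewrite !big_cons expND ?IHs// sume_ge0.
Qed.

Lemma measurable_expN : measurable_fun setT (@expN R).
Proof.
rewrite (_ : expN = fine \o er_map (fun r => expR (- r))); last first.
  by apply/funext => -[].
apply: measurableT_comp; first exact: fine_measurable.
apply: (@measurable_er_map _ (measurableTypeR R)).
by apply: measurableT_comp => //; exact: measurable_expR.
Qed.

(** The limit [+oo] has to be allowed, since the series over the points may diverge at some
    outcomes. *)
Lemma cvg_expN (u : nat -> \bar R) (l : \bar R) : (forall n, 0 <= u n)%E ->
  u n @[n --> \oo] --> l -> expN (u n) @[n --> \oo] --> expN l.
Proof.
move=> u0; case: l => [r| |] ul.
- have [ufin ur] := (fine_cvgP _ _).1 ul.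
  apply: (@cvg_trans _ ((expR (- fine (u n))) @[n --> \oo])).
    apply: near_eq_cvg; near=> n.
    have : u n \is a fin_num by near: n; exact: ufin.
    by case: (u n).
  apply: (@cvg_comp _ _ _ (fun n => - fine (u n)) expR _ (nbhs (- r))).
    exact: cvgN.
  exact: continuous_expR.
- apply/cvgrPdist_lt => e e0.
  (* Beyond [- ln (e / 2)] the exponential is at most [e / 2]. *)
  have /cvgeyPge/(_ (- ln (e / 2))) H := ul.
  near=> n.
  have : ((- ln (e / 2))%:E <= u n)%E by near: n.
  rewrite /= sub0r normrN ger0_norm ?expN_ge0//.
  case: (u n) => [s| |]//=; rewrite lee_fin => es.
  rewrite (@le_lt_trans _ _ (e / 2))//; last by lra.
  rewrite -[leRHS]lnK ?posrE ?divr_gt0// ler_expR; lra.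
- exfalso; have /cvgeNyPle/(_ (-1)) H := ul.
  near \oo => n.
  have : (u n <= (-1)%:E)%E by near: n.
  by rewrite leNgt (lt_le_trans _ (u0 n))// lte_fin ltrN10.
Unshelve. all: by end_near. Qed.

End expN_theory.

Lemma bounded_cvg_integral {d} {T : measurableType d} {R : realType}
    (P : probability T R) (f_ : nat -> T -> R) (f : T -> R) :
  (forall n, measurable_fun setT (f_ n)) ->
  (forall n w, 0 <= f_ n w <= 1) ->
  (forall w, f_ n w @[n --> \oo] --> f w) ->
  (\int[P]_w (f_ n w)%:E)%E @[n --> \oo] --> (\int[P]_w (f w)%:E)%E.
Proof.
move=> mf f01 ff.
have m1 n : measurable_fun setT (fun w => (f_ n w)%:E) by exact/measurable_EFinP.
have m2 : measurable_fun setT (fun w => (f w)%:E).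
  apply/measurable_EFinP.
  by apply: (measurable_fun_cvg mf) => // w _; exact: ff.
have m3 : {ae P, forall w, setT w -> (f_ n w)%:E @[n --> \oo] --> (f w)%:E}.
  apply: aeW => w _; apply: cvg_EFin; first exact: nearW.
  exact: ff.
have m4 : P.-integrable setT (cst 1%E : T -> \bar R).
  exact: finite_measure_integrable_cst.
have m5 : {ae P, forall w n, setT w -> (`|(f_ n w)%:E| <= cst 1 w)%E}.
  by apply: aeW => w n _; rewrite lee_fin ger0_norm; case/andP: (f01 n w).
by have [_ _] := dominated_convergence measurableT m1 m2 m3 m4 m5.
Qed.

Lemma measurable_count_pts {d} {Om : measurableType d} {R : realType}
    (X : nat -> Om -> R * R) (B : set (R * R)) :
  (forall k, measurable_fun setT (X k)) -> measurable B ->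
  measurable_fun setT (count_pts X B).
Proof.
move=> mX mB.
rewrite /count_pts.
apply: (@ge0_emeasurable_sum _ _ _ _ (fun k w => ((X k w \in B)%:R)%:E) xpredT) => // k _.
apply/measurable_EFinP.
apply: (@measurableT_comp _ _ _ _ _ _ (\1_B : R * R -> R)) => //.
Qed.

Lemma nneseries_expR {R : realType} (c x : R) : 0 <= c -> 0 <= x ->
  (\sum_(0 <= j <oo) (c * (x ^+ j / j`!%:R))%:E)%E = (c * expR x)%:E.
Proof.
move=> c0 x0; apply/cvg_lim => //.
rewrite (_ : (fun n => _) = EFin \o (fun n => c * series (exp_coeff x) n)); last first.
  by apply/funext => n /=; rewrite sumEFin -mulr_sumr.
apply: cvg_EFin; first exact: nearW.
apply: cvgM; first exact: cvg_cst.
exact: is_cvg_series_exp_coeff.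
Qed.

(** A convergent series of zeros and ones has a tail below 1; all terms of that tail are then 0, and
    the count is a finite sum. *)
Lemma count_pts_nat {Om : Type} {R : realType} (X : nat -> Om -> R * R)
    (B : set (R * R)) (w : Om) :
  count_pts X B w = +oo%E \/ exists j : nat, count_pts X B w = j%:R%:E.
Proof.
pose c k : \bar R := ((X k w \in B)%:R)%:E.
have c0 k : (0 <= c k)%E by rewrite lee_fin.
have [->|Noo] := eqVneq (count_pts X B w) +oo%E; [by left|right].
have Nlt : (\sum_(0 <= k <oo) c k < +oo)%E by rewrite ltey.
have /fine_cvgP[tfin t0] := nneseries_tail_cvg Nlt (fun k _ => c0 k).
have [n tn] : exists n, (\sum_(n <= k <oo) c k < 1)%E.
  near \oo => n; exists n.
  have : (\sum_(n <= k <oo) c k)%E \is a fin_num by near: n; exact: tfin.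
  move=> /fineK <-; rewrite lte_fin (le_lt_trans (ler_norm _))//.
  near: n; have /cvgrPdist_lt/(_ 1 ltr01) := t0.
  by under eq_near do rewrite sub0r normrN.
have cn k : (n <= k)%N -> c k = 0%E.
  move=> nk; rewrite /c; case: (boolP (X k w \in B)) => // XB; exfalso.
  move: tn; apply/negP; rewrite -leNgt.
  apply: (le_trans _ (nneseries_lim_ge k.+1 _)) => [|i _ _]; last exact: c0.
  by rewrite big_nat_recr//= /c XB leeDr// sume_ge0.
exists (\sum_(0 <= k < n) (X k w \in B))%N.
rewrite /count_pts -/c (nneseries_split 0 n)//.
rewrite add0n [X in (_ + X)%E]eseries0 ?adde0; last by move=> k nk _; exact: cn.
by rewrite sumEFin natr_sum.
Unshelve. all: by end_near. Qed.

(** * Joint Laplace transform of the counts of disjoint bounded sets *)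

Section joint_laplace.
Context {d} {Om : measurableType d} {R : realType} (P : probability Om R).
Variables (lam : R) (X : nat -> Om -> R * R).
Hypotheses (lam0 : 0 < lam) (hX : is_PPP P lam X).
Variables (m : nat) (B : 'I_m -> set (R * R)) (v : 'I_m -> R).
Hypothesis mB : forall i, measurable (B i) /\ bounded2 (B i).
Hypothesis dB : forall i i', i != i' -> B i `&` B i' = set0.
Hypothesis v0 : forall i, 0 < v i.

Let Lam i := lam * fine (leb2 (B i)).
Let pmf i (j : nat) : R := expR (- Lam i) * Lam i ^+ j / j`!%:R.
Let N (i : 'I_m) w := count_pts X (B i) w.
(** Interpolates between two integrands: at [k = 0] the product of the factors is the indicator of
    prescribed counts, whose mean [is_PPP] gives, and at [k = m] it is the integrand of the joint
    Laplace transform. *)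
Let factor (k : nat) (j : 'I_m -> nat) (i : 'I_m) w : R :=
  if (i < k)%N then expN ((v i)%:E * N i w)%E else (N i w == (j i)%:R%:E)%:R.

Let N_ge0 i w : (0 <= N i w)%E.
Proof. by apply: nneseries_ge0 => k _ _; rewrite lee_fin. Qed.

Let Lam_ge0 i : 0 <= Lam i.
Proof. by rewrite mulr_ge0 ?(ltW lam0)// fine_ge0//; exact: measure_ge0. Qed.

Let mN i : measurable_fun setT (N i).
Proof. by apply: measurable_count_pts; [exact: hX.1|exact: (mB i).1]. Qed.

Let eqN_mem i w y : (N i w == y) = (w \in [set w | N i w = y]).
Proof. by apply/eqP/idP => [Ny|/set_mem//]; exact/mem_set. Qed.

Let measurable_eqN i y : measurable [set w | N i w = y].
Proof. by have := mN i measurableT (emeasurable_set1 y); rewrite setTI. Qed.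

Let measurable_fun_eqN i y : measurable_fun setT (fun w => (N i w == y)%:R : R).
Proof.
have -> : (fun w => (N i w == y)%:R) = \1_[set w | N i w = y] :> (Om -> R).
  by apply/funext => w; rewrite indicE eqN_mem.
exact: measurable_indic.
Qed.

Let measurable_factor k j i : measurable_fun setT (factor k j i).
Proof.
rewrite /factor; case: (i < k)%N => //.
by apply: (measurableT_comp measurable_expN); exact: measurable_funeM.
Qed.

Let factor_ge0 k j i w : 0 <= factor k j i w.
Proof. by rewrite /factor; case: ifPn => // _; exact: expN_ge0. Qed.

(** For a finite count exactly one term survives. For an infinite count both sides are 0, the left
    one because [v i > 0]. *)
Lemma expN_count i w : (expN ((v i)%:E * N i w)%E)%:E =
  (\sum_(0 <= j <oo) (expR (- (v i * j%:R)) * (N i w == j%:R%:E)%:R)%:E)%E.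
Proof.
rewrite /N; case: (count_pts_nat X (B i) w) => [->|[j ->]].
  rewrite gt0_muley ?lte_fin//= eseries0// => k _ _.
  by rewrite mulr0.
rewrite (@nneseriesD1 _ _ j)//.
rewrite eseries0 => [|k _ /= kj].
  by rewrite eqxx mulr1 adde0.
by rewrite eqe eqr_nat eq_sym (negbTE kj) mulr0.
Qed.

(** Induction on [k], trading one indicator for one exponential: the exponential is expanded over
    the possible counts of one set, and the Poisson weights sum to
    [exp (- Lam i * (1 - exp (- v i)))]. *)
Lemma ppp_joint k j :
  (\int[P]_w (\prod_(i < m) factor k j i w)%:E)%E =
  (\prod_(i < m) (if (i < k)%N then expR (- (Lam i * (1 - expR (- v i))))
                  else pmf i (j i)))%:E.
Proof.
elim: k j => [|k IHk] j.
  set A := \big[setI/setT]_(i < m) [set w | N i w = (j i)%:R%:E].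
  have mA : measurable A by apply: bigsetI_measurable.
  transitivity (\int[P]_w (\1_A w)%:E)%E.
    apply: eq_integral => w _; congr (_%:E); rewrite indicE /A.
    rewrite (@big_morph _ _ (fun S : set Om => (w \in S)%:R : R) 1 *%R setT setI).
    - by apply: eq_bigr => i _; rewrite /factor ltn0 eqN_mem.
    - by move=> S1 S2; rewrite in_setI -natrM mulnb.
    - by rewrite in_setT.
  rewrite integral_indic// setIT; apply: (etrans (hX.2 m B j mB dB)).
  by rewrite prodEFin.
have [mk|km] := leqP m k.
  have E (i : 'I_m) : (i < k.+1)%N = (i < k)%N.
    by rewrite (leq_trans (ltn_ord i) mk) ltnS ltnW// (leq_trans (ltn_ord i) mk).
  rewrite /factor; under eq_bigr do rewrite E.
  rewrite -(IHk j); apply: eq_integral => w _; congr (_%:E).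
  by apply: eq_bigr => i _; rewrite E.
pose i0 := Ordinal km.
have E (i : 'I_m) : i != i0 -> (i < k.+1)%N = (i < k)%N.
  by move=> ii0; rewrite ltnS leq_eqVlt orb_idl// => /eqP ik; case/eqP: ii0; exact/val_inj.
pose C := \prod_(i < m | i != i0) (if (i < k)%N then expR (- (Lam i * (1 - expR (- v i))))
                  else pmf i (j i)).
pose W w := \prod_(i < m | i != i0) factor k j i w.
(* This is the induction hypothesis for the prescribed counts [j] with the entry at [i0] replaced by
   [jj]. *)
have step (jj : nat) : (\int[P]_w ((N i0 w == jj%:R%:E)%:R * W w)%:E)%E = (pmf i0 jj * C)%:E.
  have := IHk (fun i => if i == i0 then jj else j i).
  rewrite (bigD1 i0)//= ltnn eqxx.
  rewrite (eq_bigr (fun i : 'I_m => if (i < k)%N then expR (- (Lam i * (1 - expR (- v i))))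
                  else pmf i (j i))); last by move=> i /negbTE ->.
  move=> <-; apply: eq_integral => w _; congr (_%:E).
  rewrite [RHS](bigD1 i0)//= /factor ltnn eqxx; congr (_ * _).
  by apply: eq_bigr => i /negbTE ->.
rewrite (bigD1 i0)//= ltnSn.
rewrite (eq_bigr (fun i : 'I_m => if (i < k)%N then expR (- (Lam i * (1 - expR (- v i))))
                  else pmf i (j i))); last by move=> i /E ->.
rewrite -/C.
have W0 w : 0 <= W w by apply: prodr_ge0 => i _.
have mW : measurable_fun setT W.
  rewrite (_ : W = fun w => \prod_(i < m) (if i != i0 then factor k j i w else 1)).
    by apply: measurable_prod => i _; case: (i != i0).
  by apply/funext => w; rewrite -big_mkcond.
transitivity (\int[P]_w \sum_(0 <= jj <oo)
   (expR (- (v i0 * jj%:R)) * ((N i0 w == jj%:R%:E)%:R * W w))%:E)%E.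
  apply: eq_integral => w _.
  rewrite (bigD1 i0)//= {1}/factor ltnSn EFinM expN_count muleC.
  rewrite (_ : \prod_(i < m | i != i0) factor k.+1 j i w = W w); last first.
    by apply: eq_bigr => i /E E'; rewrite /factor E'.
  rewrite -nneseriesZl//.
  by apply: eq_eseriesr => jj _; rewrite -EFinM; congr (_%:E); ring.
rewrite integral_nneseries//.
- transitivity (\sum_(0 <= jj <oo)
    (C * expR (- Lam i0) * ((Lam i0 * expR (- v i0)) ^+ jj / jj`!%:R))%:E)%E.
    apply: eq_eseriesr => jj _.
    under eq_integral do rewrite EFinM.
    rewrite ge0_integralZl//.
    + rewrite step -EFinM; congr (_%:E).
      rewrite /pmf (exprMn _ (Lam i0)) -expRM_natr mulNr; ring.
    + by apply/measurable_EFinP; exact: measurable_funM.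
    + by move=> w _; rewrite lee_fin mulr_ge0.
  rewrite nneseries_expR.
  + congr (_%:E); rewrite -mulrA -expRD mulrC; congr (expR _ * _); ring.
  + rewrite mulr_ge0 ?expR_ge0// prodr_ge0// => i _; case: ifPn => _; rewrite ?expR_ge0//.
    by rewrite !mulr_ge0 ?expR_ge0 ?exprn_ge0 ?invr_ge0.
  + by rewrite mulr_ge0 ?expR_ge0.
- move=> jj; apply/measurable_EFinP; apply: measurable_funM => //.
  exact: measurable_funM.
- by move=> jj w _; rewrite lee_fin !mulr_ge0 ?expR_ge0.
Qed.

Lemma ppp_joint_laplace :
  (\int[P]_w (\prod_(i < m) expN ((v i)%:E * count_pts X (B i) w)%E)%:E)%E =
  (expR (- (lam * \sum_(i < m) (1 - expR (- v i)) * fine (leb2 (B i)))))%:E.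
Proof.
have := ppp_joint m (fun=> 0%N).
under [X in _ = X%:E -> _]eq_bigr do rewrite ltn_ord.
rewrite -expR_sum => H.
transitivity (\int[P]_w (\prod_(i < m) factor m (fun=> 0%N) i w)%:E)%E.
  apply: eq_integral => w _; congr (_%:E).
  by apply: eq_bigr => i _; rewrite /factor ltn_ord.
rewrite H; congr (expR _)%:E.
by rewrite mulr_sumr -sumrN; apply: eq_bigr => i _; rewrite /Lam; ring.
Qed.

End joint_laplace.

(** * Laplace functional: simple functions, then monotone limits *)

Section laplace_functional.
Context {d} {Om : measurableType d} {R : realType} (P : probability Om R).
Variables (lam : R) (X : nat -> Om -> R * R).
Hypotheses (lam0 : 0 < lam) (hX : is_PPP P lam X).
Notation mR := (measurableTypeR R).
Notation leb := (@lebesgue_measure R).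
Notation T2 := (mR * mR)%type.

Import HBNNSimple.

Lemma leb2_bounded_lty (B : set (R * R)) : measurable B -> bounded2 B ->
  (leb2 B < +oo)%E.
Proof.
move=> mB [c Bc].
have mC : measurable (`[- c, c] `*` `[- c, c] : set T2) by exact: measurableX.
apply: (@le_lt_trans _ _ (leb2 (`[- c, c] `*` `[- c, c]))).
  apply: le_measure; rewrite ?inE//.
  by move=> p /Bc/= [p1 p2]; split; rewrite /= in_itv/= -ler_norml.
have L : (leb `[(- c)%R, c] < +oo)%E.
  by rewrite lebesgue_measure_itv/=; case: ifPn => _; rewrite ?ltry// -EFinB ltry.
rewrite /leb2 product_measure1E// lte_mul_pinfty//.
by rewrite ge0_fin_numE.
Qed.

Lemma ppp_laplace_simple (g : {nnsfun T2 >-> R}) :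
  bounded2 [set p : R * R | g p != 0] ->
  (\int[P]_w (expN (\sum_(0 <= k <oo) (g (X k w))%:E))%:E)%E =
  (expR (- (lam * fine (\int[leb \x leb]_p (1 - expR (- g p))%:E)%E)))%:E.
Proof.
move=> bg.
(* The value 0 is discarded: its level set is unbounded, while the law of the counts is given for
   bounded sets only. *)
pose s := [seq y <- finmap.enum_fset (fset_set (range g)) | y != 0].
pose m := size s.
pose v (i : 'I_m) := tnth (in_tuple s) i.
pose B (i : 'I_m) : set (R * R) := g @^-1` [set v i].
have vs i : v i \in s by exact: mem_tnth.
have v0 i : 0 < v i.
  have := vs i; rewrite mem_filter => /andP[vi].
  rewrite in_fset_set// inE => -[p _ gp].
  by rewrite lt_neqAle eq_sym vi -gp/=.
have us : uniq s by rewrite filter_uniq//; exact: finmap.fset_uniq.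
have mB i : measurable (B i) /\ bounded2 (B i).
  split; first exact: (measurable_funPTI g).
  have [c gc] := bg; exists c => p /= gp; apply: gc => /=.
  by rewrite gp gt_eqF.
have dB i i' : i != i' -> B i `&` B i' = set0.
  move=> ii'; apply/seteqP; split => // p [/= gi gi'].
  have vv : v i = v i' by rewrite -gi -gi'.
  by move/negP: ii'; apply; apply/eqP; exact: (tuple_uniqP (in_tuple s) us _ _ vv).
(* Used with the identity for the sum over the points and with [1 - exp (- x)] for the exponent;
   both vanish at 0. *)
have sumE (F : R -> R) p : F 0 = 0 -> F (g p) = \sum_(i < m) F (v i) * (p \in B i)%:R.
  move=> F0; have [gp0|gp0] := eqVneq (g p) 0.
    rewrite gp0 F0 big1// => i _; rewrite memNset ?mulr0//= => gpv.
    by have := v0 i; rewrite -gpv gp0 ltxx.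
  have /tnthP[i gpi] : g p \in in_tuple s.
    by rewrite mem_filter gp0 in_fset_set// inE; exists p.
  rewrite (bigD1 i)//= mem_set//= mulr1 big1 ?addr0 ?gpi// => i' ii'.
  rewrite memNset ?mulr0// => gpi'.
  have : (B i `&` B i') p by split.
  by rewrite dB// eq_sym.
have H := ppp_joint_laplace lam0 hX mB dB v0.
transitivity (\int[P]_w (\prod_(i < m) expN ((v i)%:E * count_pts X (B i) w)%E)%:E)%E.
  apply: eq_integral => w _; congr (_%:E).
  rewrite -expN_sum; last first.
    move=> i; apply: mule_ge0; first by rewrite lee_fin ltW.
    by apply: nneseries_ge0 => k _ _; rewrite lee_fin.
  congr expN.
  transitivity (\sum_(0 <= k <oo) \sum_(i < m) ((v i)%:E * ((X k w \in B i)%:R)%:E))%E.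
    apply: eq_eseriesr => k _; rewrite (sumE id)// -sumEFin.
    by apply: eq_bigr => i _; rewrite EFinM.
  rewrite nneseries_sum; last first.
    by move=> i k _; rewrite -EFinM lee_fin mulr_ge0// ltW.
  by apply: eq_bigr => i _; rewrite nneseriesZl.
rewrite H; congr (expR (- (_ * _)))%:E.
have LE i : leb2 (B i) = (fine (leb2 (B i)))%:E.
  by rewrite fineK// ge0_fin_numE ?measure_ge0//; apply: leb2_bounded_lty; case: (mB i).
suff -> : (\int[leb \x leb]_p (1 - expR (- g p))%:E)%E =
    (\sum_(i < m) (1 - expR (- v i)) * fine (leb2 (B i)))%:E by [].
rewrite -sumEFin; apply/esym.
transitivity (\sum_(i < m) \int[leb \x leb]_p ((1 - expR (- v i))%:E * (\1_(B i) p)%:E))%E.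
  apply: eq_bigr => i _.
  rewrite EFinM -LE ge0_integralZl//.
  - rewrite integral_indic ?setIT//.
    exact: (mB i).1.
  - apply/measurable_EFinP; apply: measurable_indic; exact: (mB i).1.
  - by rewrite lee_fin subr_ge0 expR_le1 oppr_le0 ltW.
rewrite -ge0_integral_sum//.
- apply: eq_integral => p _; rewrite (sumE (fun x => 1 - expR (- x))); last first.
    by rewrite oppr0 expR0 subrr.
  by rewrite -sumEFin; apply: eq_bigr => i _; rewrite -EFinM indicE.
- move=> i; apply: measurable_funeM.
  apply/measurable_EFinP; apply: measurable_indic; exact: (mB i).1.
- move=> i p _; rewrite -EFinM lee_fin mulr_ge0//.
  by rewrite subr_ge0 expR_le1 oppr_le0 ltW.
Qed.

(** Monotone convergence for the counting measure on the indices. *)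
Lemma cvg_nneseries_nondecreasing (u : nat -> nat -> R) (l : nat -> R) :
  (forall n k, 0 <= u n k) -> (forall k, nondecreasing_seq (u ^~ k)) ->
  (forall k, u n k @[n --> \oo] --> l k) ->
  (\sum_(0 <= k <oo) (u n k)%:E)%E @[n --> \oo] --> (\sum_(0 <= k <oo) (l k)%:E)%E.
Proof.
move=> u0 ndu ul.
have l0 k : 0 <= l k.
    rewrite -(cvg_lim _ (ul k))//; apply: limr_ge; first exact: cvgP (ul k).
    exact: nearW.
pose cnt : {measure set nat -> \bar R} := counting.
have : (\int[cnt]_k (u n k)%:E)%E @[n --> \oo] --> (\int[cnt]_k limn (fun n => (u n k)%:E))%E.
  apply: cvg_monotone_convergence => //.
    by move=> n k _; rewrite lee_fin.
  by move=> k _ a b ab; rewrite lee_fin; exact: ndu.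
rewrite (_ : (\int[cnt]_k limn (fun n => (u n k)%:E))%E = (\sum_(0 <= k <oo) (l k)%:E)%E).
  have -> : (fun n => \int[cnt]_k (u n k)%:E)%E = (fun n => \sum_(0 <= k <oo) (u n k)%:E)%E.
    by apply/funext => n; rewrite ge0_integral_count// => k; rewrite lee_fin.
  by [].
rewrite -ge0_integral_count//; apply: eq_integral => k _; apply/cvg_lim => //.
by apply: cvg_EFin; [exact: nearW|exact: ul].
Qed.

(** The finiteness hypothesis keeps [fine] from turning an infinite exponent into 0. It also makes
    [fine] continuous at the limit of the exponents. *)
Lemma ppp_laplace (f : R * R -> R) : measurable_fun setT f ->
  (forall p, 0 <= f p) ->
  (\int[leb \x leb]_p (1 - expR (- f p))%:E < +oo)%E ->
  (\int[P]_w (expN (\sum_(0 <= k <oo) (f (X k w))%:E))%:E)%E =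
  (expR (- (lam * fine (\int[leb \x leb]_p (1 - expR (- f p))%:E)%E)))%:E.
Proof.
move=> mf f0 foo.
have mf' : @measurable_fun _ _ T2 _ setT (EFin \o f) by exact/measurable_EFinP.
pose h := nnsfun_approx measurableT mf'.
(* Truncating to growing squares gives the simple approximations bounded support and keeps them
   nondecreasing. *)
pose S n : set T2 := `[- n%:R, n%:R] `*` `[- n%:R, n%:R].
have mS n : measurable (S n) by exact: measurableX.
pose g n := proj_nnsfun (h n) (mS n).
have gE n p : g n p = h n p * \1_(S n) p by [].
have ndS a b p : (a <= b)%N -> (\1_(S a) p : R) <= \1_(S b) p.
  move=> ab; rewrite !indicE; have [/set_mem|] := boolP (p \in S a); last by rewrite ler0n.
  rewrite /S /= !in_itv/= -!ler_norml => -[p1 p2].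
  rewrite mem_set//= !in_itv/= -!ler_norml.
  by split; [apply: (le_trans p1)|apply: (le_trans p2)]; rewrite ler_nat.
have ndg p : nondecreasing_seq (fun n => g n p).
  move=> a b ab; rewrite !gE ler_pM//; last exact: ndS.
  exact/lefP/nd_nnsfun_approx.
have gf p : g n p @[n --> \oo] --> f p.
  have hf : h n p @[n --> \oo] --> f p.
    have : (h n p)%:E @[n --> \oo] --> (f p)%:E.
      by apply: cvg_nnsfun_approx => // q _; rewrite lee_fin.
    by move=> /fine_cvg.
  apply: cvg_trans hf; apply: near_eq_cvg; near=> n.
  have Sp : S n p.
    rewrite /S /= !in_itv/= -!ler_norml; split; near: n; exact: nbhs_infty_ger.
  by rewrite gE indicE mem_set ?mulr1.
have bg n : bounded2 [set p : R * R | g n p != 0].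
  exists n%:R => p gp; have {gp} : g n p != 0 by exact: gp.
  rewrite gE mulf_eq0 negb_or => /andP[_].
  rewrite indicE pnatr_eq0 eqb0 negbK => /set_mem.
  by rewrite /S /= !in_itv/= -!ler_norml.
have mX k := hX.1 k.
have H1 : (\int[P]_w (expN (\sum_(0 <= k <oo) (g n (X k w))%:E))%:E)%E @[n --> \oo] -->
    (\int[P]_w (expN (\sum_(0 <= k <oo) (f (X k w))%:E))%:E)%E.
  apply: bounded_cvg_integral.
  - move=> n; apply: (measurableT_comp measurable_expN).
    apply: (@ge0_emeasurable_sum _ _ _ _ (fun k w => (g n (X k w))%:E) xpredT).
      by move=> k w _ _; rewrite lee_fin.
    move=> k _.
    apply/measurable_EFinP.
    have mgn' : @measurable_fun _ _ T2 R setT (g n) by [].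
    have mgn : @measurable_fun _ _ (R * R)%type R setT (g n) by exact: mgn'.
    exact: (measurableT_comp mgn).
  - move=> n w; rewrite expN_ge0 expN_le1//.
    by apply: nneseries_ge0 => k _ _; rewrite lee_fin.
  - move=> w; apply: cvg_expN.
      by move=> n; apply: nneseries_ge0 => k _ _; rewrite lee_fin.
    by apply: cvg_nneseries_nondecreasing.
have H2 : (\int[leb \x leb]_p (1 - expR (- g n p))%:E)%E @[n --> \oo] -->
   (\int[leb \x leb]_p (1 - expR (- f p))%:E)%E.
  have -> : (\int[leb \x leb]_p (1 - expR (- f p))%:E =
      \int[leb \x leb]_p limn (fun n => (1 - expR (- g n p))%:E))%E.
    apply: eq_integral => p _; apply/esym/cvg_lim => //.
    apply: cvg_EFin; first exact: nearW.
    apply: cvgB; first exact: cvg_cst.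
    apply: (@cvg_comp _ _ _ (fun n => - g n p) expR _ (nbhs (- f p))).
      exact: cvgN.
    exact: continuous_expR.
  apply: cvg_monotone_convergence => //.
  - move=> n; apply/measurable_EFinP; apply: measurable_funB => //.
    by apply: measurableT_comp => //; exact: measurableT_comp.
  - by move=> n p _; rewrite lee_fin subr_ge0 expR_le1 oppr_le0.
  - by move=> p _ a b ab; rewrite lee_fin lerB// ler_expR lerN2; exact: ndg.
apply: (cvg_unique _ H1) => //.
rewrite (_ : (fun n => _) = (fun n => (expR (- (lam * fine (\int[leb \x leb]_p (1 - expR (- g n p))%:E)%E)))%:E)); last first.
  by apply/funext => n; rewrite ppp_laplace_simple.
apply: cvg_EFin; first exact: nearW.
apply: (@cvg_comp _ _ _ (fun n => - (lam * fine (\int[leb \x leb]_p (1 - expR (- g n p))%:E)%E)) expR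
  _ (nbhs (- (lam * fine (\int[leb \x leb]_p (1 - expR (- f p))%:E)%E)))).
  apply: cvgN; apply: cvgM; first exact: cvg_cst.
  apply: fine_cvg; rewrite fineK//.
  by rewrite ge0_fin_numE// integral_ge0// => p _; rewrite lee_fin subr_ge0 expR_le1 oppr_le0.
exact: continuous_expR.
Unshelve. all: by end_near. Qed.

End laplace_functional.

(** * Sources of randomness of the model *)

Section sigma_rv_ev.
Context {d d'} {Om : measurableType d} {T : measurableType d'}.

Lemma sigma_rv_measurable (f : Om -> T) :
  measurable_fun setT f -> sigma_rv f `<=` measurable.
Proof. by move=> mf _ [B mB <-]; rewrite -[X in measurable X]setTI; exact: mf. Qed.

Lemma sigma_rv_setI (f : Om -> T) : setI_closed (sigma_rv f).
Proof.
move=> _ _ [A mA <-] [B mB <-]; exists (A `&` B) => //.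
exact: measurableI.
Qed.

Lemma sigma_rv_setT (f : Om -> T) : sigma_rv f setT.
Proof. by exists setT. Qed.

Lemma sigma_ev_measurable (E : set Om) : measurable E -> sigma_ev E `<=` measurable.
Proof.
by move=> mE _ [|[|[]]] -> //; exact: measurableC.
Qed.

Lemma sigma_ev_setI (E : set Om) : setI_closed (sigma_ev E).
Proof.
move=> A B [|[|[]]] -> [|[|[]]] ->;
  rewrite ?(setI0, set0I, setIid, setTI, setIT, setICr, setICl) /sigma_ev/=; tauto.
Qed.

Lemma sigma_ev_setT (E : set Om) : sigma_ev E setT.
Proof. by right; right; right. Qed.

End sigma_rv_ev.

Lemma g_sigma_algebra_sub {d} {Om : measurableType d} (G : set (set Om)) :
  G `<=` measurable -> <<s G >> `<=` measurable.
Proof. by move=> Gm; apply: smallest_sub => //; exact: sigma_algebra_measurable. Qed.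

(** Points and line-of-sight events form a single source, because the latter depend on the former
    through the distances. *)
Definition model_sigma {d} {Om : measurableType d} {R : realType}
  (X : nat -> Om -> R * R) (L : nat -> set Om) (h Mt : nat -> Om -> R)
  (h0 : Om -> R) (L0 : set Om) (s : src) : set (set Om) :=
  match s with
  | sXL => <<s (\bigcup_k sigma_rv (X k)) `|` (\bigcup_k sigma_ev (L k)) >>
  | sH0 => sigma_rv h0
  | sL0 => sigma_ev L0
  | sH k => sigma_rv (h k)
  | sM k => sigma_rv (Mt k) end.

Lemma measurable_fun_if_set {d d'} {T : measurableType d} {T' : measurableType d'}
    (E : set T) (f g : T -> T') : measurable E ->
  measurable_fun setT f -> measurable_fun setT g ->
  measurable_fun setT (fun w => if `[< E w >] then f w else g w).
Proof.
move=> mE mf mg; apply: measurable_fun_ifT => //.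
apply: (measurable_fun_bool true).
rewrite setTI (_ : _ @^-1` _ = E)//.
by apply/seteqP; split => w /=; [move=> /asboolP|move=> ?; apply/asboolP].
Qed.

Lemma measurable_fun_powRl {d} {T : measurableType d} {R : realType} (p : R) (f : T -> R) :
  measurable_fun setT f -> measurable_fun setT (fun x => f x `^ p).
Proof. by move=> mf; exact: (measurableT_comp (measurable_powR p)). Qed.

Lemma measurable_gain {R : realType} (G g : R) : measurable_fun setT (gain G g).
Proof.
apply: measurable_fun_ifT => //; first exact: measurable_fun_eqr.
by apply: measurable_fun_ifT => //; exact: measurable_fun_eqr.
Qed.

Lemma gain_ge0 {R : realType} (G g c : R) : 0 < G -> 0 < g -> 0 <= gain G g c.
Proof.
by move=> G0 g0; rewrite /gain; do 2?case: ifPn => _; rewrite mulr_ge0// ltW.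
Qed.

(** * Integrating out the line-of-sight marks *)

Lemma uniq_NoDup (T : eqType) (s : seq T) : uniq s -> List.NoDup s.
Proof.
have In_mem (x : T) s' : List.In x s' -> x \in s'.
  elim: s' => // y s' IH [->|/IH xs]; first by rewrite mem_head.
  by rewrite inE xs orbT.
elim: s => [_|x s IH /= /andP[xs us]]; first exact: List.NoDup_nil.
apply: List.NoDup_cons; last exact: IH.
by move=> /In_mem; rewrite (negbTE xs).
Qed.

(** The identity is measurable onto the coarser sigma-algebra, so this is a change of variables. It
    allows densities to be handled on the events of the points alone, the only ones [los_marks]
    speaks of. *)
Lemma integral_coarser {d} {Om : measurableType d} {R : realType} (G : set (set Om))
    (P : {measure set Om -> \bar R})
    (m : {measure set (g_sigma_algebraType G) -> \bar R})
    (E : set (g_sigma_algebraType G)) (f : Om -> \bar R) :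
  G `<=` measurable -> (forall A, m A = P A) -> measurable E ->
  measurable_fun E (f : g_sigma_algebraType G -> \bar R) -> (forall w, 0 <= f w)%E ->
  (\int[m]_(w in E) f w = \int[P]_(w in E) f w)%E.
Proof.
move=> Gm mE0 mE mf f0.
have mid : measurable_fun setT (id : Om -> g_sigma_algebraType G).
  by move=> _ B mB; rewrite setTI; exact: (g_sigma_algebra_sub Gm).
have := @ge0_integral_pushforward _ _ Om (g_sigma_algebraType G) R id mid P E f mE mf (fun w _ => f0 w).
rewrite preimage_id => <-.
by apply: eq_measure_integral => A mA _; rewrite mE0.
Qed.

Section los.
Context {d} {Om : measurableType d} {R : realType} (P : probability Om R).
Variables (beta : R) (X : nat -> Om -> R * R) (L : nat -> set Om).
Hypothesis mX : forall k, measurable_fun setT (X k).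
Hypothesis hL : los_marks P beta X L.
Hypothesis beta0 : 0 < beta.
Notation GX := (\bigcup_k sigma_rv (X k)).
Notation OX := (g_sigma_algebraType GX).

Let GXm : GX `<=` measurable.
Proof. by move=> A [k _]; exact: sigma_rv_measurable. Qed.

Let lpX j w := lp beta (dist0 (X j w)).
Let D j (c : bool) w : R := if c then lpX j w else 1 - lpX j w.
Let ind j (c : bool) w : R := (`[< L j w >] == c)%:R.

Lemma lp_le1 (x : R) : 0 <= x -> lp beta x <= 1.
Proof. by move=> x0; rewrite expR_le1 oppr_le0 mulr_ge0// ltW. Qed.

Lemma measurable_lp : measurable_fun setT (lp beta).
Proof.
apply: (measurableT_comp (@measurable_expR R)); apply: measurable_funN.
exact: measurable_funM.
Qed.

Let D_ge0 j c w : 0 <= D j c w.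
Proof. by rewrite /D /lpX; case: c; rewrite ?expR_ge0// subr_ge0 lp_le1// dist0_ge0. Qed.

Let OX_X j : measurable_fun setT (X j : OX -> R * R).
Proof.
move=> _ B mB; rewrite setTI; apply: sub_sigma_algebra; exists j => //.
by exists B.
Qed.

Let OX_D j c : measurable_fun setT (D j c : OX -> R).
Proof.
have mlX : measurable_fun setT (lpX j : OX -> R).
  apply: (measurableT_comp measurable_lp).
  by apply: (measurableT_comp measurable_dist0); exact: OX_X.
by rewrite /D; case: c => //; exact: measurable_funB.
Qed.

Let OX_Om {d'} {T : measurableType d'} (f : Om -> T) :
  measurable_fun setT (f : OX -> T) -> measurable_fun setT f.
Proof.
by move=> mf _ B mB; exact: (g_sigma_algebra_sub GXm) (mf measurableT B mB).
Qed.

(** [los_marks] says that, on the events of the points, the measure [P] restricted to a prescribed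
    line-of-sight pattern has density the product of the [D j (b j)]. Integrating against a density
    extends this from events to functions [f] of the points. *)
Let los_density K (b : nat -> bool) (f : Om -> R) :
  measurable_fun setT (f : OX -> R) -> (forall w, 0 <= f w) ->
  (\int[P]_w (f w * \prod_(j < K) ind j (b j) w)%:E)%E =
  (\int[P]_w (f w * \prod_(j < K) D j (b j) w)%:E)%E.
Proof.
move=> mf f0.
pose J := index_iota 0 K.
pose Lb := \big[setI/setT]_(j <- J) (if b j then L j else ~` L j).
have mLb : measurable Lb.
  apply: bigsetI_measurable => j _; case: (b j); first exact: hL.1.
  by apply: measurableC; exact: hL.1.
have indE w : \prod_(j < K) ind j (b j) w = \1_Lb w.
  rewrite indicE /Lb (@big_morph _ _ (fun S : set Om => (w \in S)%:R : R) 1 *%R setT setI).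
  - rewrite big_mkord; apply: eq_bigr => j _; rewrite /ind; congr (_%:R).
    have memL : (w \in L j) = `[< L j w >].
      by apply/idP/asboolP => [/set_mem|/mem_set].
    by case: (b j); rewrite ?in_setC memL ?eqb_id ?eqbF_neg.
  - by move=> S1 S2; rewrite in_setI -natrM mulnb.
  - by rewrite in_setT.
pose DD w := \prod_(j < K) D j (b j) w.
have DD0 w : 0 <= DD w by apply: prodr_ge0 => j _.
have mDD : measurable_fun setT (DD : OX -> R).
  by apply: (@measurable_prod _ OX) => j _; exact: OX_D.
have mid : measurable_fun setT (id : Om -> OX).
  by move=> _ B mB; rewrite setTI; exact: (g_sigma_algebra_sub GXm).
(* [mu] and [m] are [P] and its restriction to the pattern, seen on the sigma-algebra of the points
   only. *)
have [mu muE] := pushforward_measure_ex P mid.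
have [m mE] := pushforward_measure_ex (mrestr P mLb) mid.
have dens (B : set OX) : measurable B -> m B = (\int[mu]_(x in B) (DD x)%:E)%E.
  move=> mB; rewrite mE preimage_id /= /mrestr.
  apply: (etrans (hL.2 J b B (uniq_NoDup (iota_uniq _ _)) mB)).
  rewrite (@integral_coarser _ _ _ GX P mu B (fun w => (DD w)%:E))//.
  - by apply: eq_integral => w _; rewrite /DD big_mkord.
  - by apply/measurable_EFinP; exact: measurable_funTS.
have dens' (B : set Om) : measurable B ->
    mrestr P mLb B = (\int[P]_(x in B) (\1_Lb x)%:E)%E.
  by move=> mB; rewrite integral_indic// setIC.
have mfE : measurable_fun setT ((fun w => (f w)%:E) : OX -> \bar R) by exact/measurable_EFinP.
have f0E w : (0 <= (f w)%:E)%E by rewrite lee_fin.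
transitivity (\int[mrestr P mLb]_w (f w)%:E)%E.
  rewrite (@ge0_integral_density _ _ _ P (mrestr P mLb) (\1_Lb) _ _ dens' (fun w => (f w)%:E))//.
  - by apply: eq_integral => w _; rewrite indE EFinM.
  - exact: OX_Om.
transitivity (\int[m]_w (f w)%:E)%E.
  by rewrite (@integral_coarser _ _ _ GX (mrestr P mLb) m setT (fun w => (f w)%:E)).
rewrite (@ge0_integral_density _ OX _ mu m DD mDD DD0 dens (fun w => (f w)%:E))//.
rewrite (@integral_coarser _ _ _ GX P mu setT (fun w => (f w)%:E * (DD w)%:E)%E)//.
- apply: emeasurable_funM => //; exact/measurable_EFinP.
- by move=> w; rewrite mule_ge0// lee_fin.
Qed.

Variables fL fN : R * R -> R.
Hypotheses (mfL : measurable_fun setT fL) (mfN : measurable_fun setT fN).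
Hypotheses (fL0 : forall p, 0 <= fL p) (fN0 : forall p, 0 <= fN p).

Let val j (c : bool) w := if c then fL (X j w) else fN (X j w).
Let V j w := val j `[< L j w >] w.
Let u j w := D j true w * val j true w + D j false w * val j false w.

Let val_ge0 j c w : 0 <= val j c w.
Proof. by rewrite /val; case: c. Qed.

Let OX_val j c : measurable_fun setT (val j c : OX -> R).
Proof. by rewrite /val; case: c; apply: measurableT_comp. Qed.

Let OX_u j : measurable_fun setT (u j : OX -> R).
Proof. by apply: measurable_funD; apply: measurable_funM. Qed.

Let Om_ind j c : measurable_fun setT (ind j c).
Proof.
have -> : ind j c = fun w => if `[< L j w >] then (true == c)%:R else (false == c)%:R.
  by apply/funext => w; rewrite /ind; case: asboolP.
by apply: measurable_fun_if_set => //; exact: hL.1.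
Qed.

Let Om_V j : measurable_fun setT (V j).
Proof.
have -> : V j = fun w => if `[< L j w >] then val j true w else val j false w.
  by apply/funext => w; rewrite /V; case: asboolP.
by apply: measurable_fun_if_set; [exact: hL.1|exact: OX_Om|exact: OX_Om].
Qed.

Let ind_ge0 j c w : 0 <= ind j c w.
Proof. exact: ler0n. Qed.

Let u_ge0 j w : 0 <= u j w.
Proof. by rewrite addr_ge0// mulr_ge0. Qed.

(** Induction on the number [m] of factors that carry a value instead of an indicator. A value is
    split along [L m] and its complement; each piece is a function of the points times an indicator.
    The function is absorbed into [f], which is why [f] is arbitrary. *)
Let los_induction K m (b : nat -> bool) (f : Om -> R) :
  measurable_fun setT (f : OX -> R) -> (forall w, 0 <= f w) ->
  (\int[P]_w (f w * \prod_(j < K) (if (j < m)%N then V j w else ind j (b j) w))%:E)%E =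
  (\int[P]_w (f w * \prod_(j < K) (if (j < m)%N then u j w else D j (b j) w))%:E)%E.
Proof.
elim: m b f => [b f mf f0|m IH b f mf f0]; first exact: los_density.
have [Km|mK] := leqP K m.
  have E (k : 'I_K) : (k < m.+1)%N = (k < m)%N.
    by rewrite (leq_trans (ltn_ord k) Km) ltnS ltnW// (leq_trans (ltn_ord k) Km).
  have := IH b f mf f0.
  under [in X in X = _ -> _]eq_integral do under eq_bigr do rewrite -E.
  by under [in X in _ = X -> _]eq_integral do under eq_bigr do rewrite -E.
pose i0 := Ordinal mK.
have E (i : 'I_K) : i != i0 -> (i < m.+1)%N = (i < m)%N.
  by move=> ii0; rewrite ltnS leq_eqVlt orb_idl// => /eqP ik; case/eqP: ii0; exact/val_inj.
(* The pattern [b] with the state of point [m] set to [c]. *)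
pose b' (c : bool) j := if j == m then c else b j.
have b'E c (i : 'I_K) : i != i0 -> b' c i = b i.
  by move=> ii0; rewrite /b'; case: eqP => // im; case/eqP: ii0; exact: val_inj.
pose W w := \prod_(j < K | j != i0) (if (j < m)%N then V j w else ind j (b j) w).
pose W' w := \prod_(j < K | j != i0) (if (j < m)%N then u j w else D j (b j) w).
have W0 w : 0 <= W w by apply: prodr_ge0 => j _; case: ifPn => _; rewrite ?val_ge0.
have W'0 w : 0 <= W' w by apply: prodr_ge0 => j _; case: ifPn => _; rewrite ?u_ge0.
have mW : measurable_fun setT W.
  rewrite (_ : W = fun w => \prod_(k < K) (if k != i0 then
    (if (k < m)%N then V k w else ind k (b k) w) else 1)); last first.
    by apply/funext => w; rewrite /W big_mkcond.
  by apply: measurable_prod => k _; case: (k != i0) => //; case: (k < m)%N.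
have mW' : measurable_fun setT W'.
  rewrite (_ : W' = fun w => \prod_(k < K) (if k != i0 then
    (if (k < m)%N then u k w else D k (b k) w) else 1)); last first.
    by apply/funext => w; rewrite /W' big_mkcond.
  apply: measurable_prod => k _; case: (k != i0) => //; case: (k < m)%N => //.
    exact: OX_Om.
  exact: OX_Om.
have mfO : measurable_fun setT f by exact: OX_Om.
have mvO c : measurable_fun setT (val m c) by exact: OX_Om.
have mDO c : measurable_fun setT (D m c) by exact: OX_Om.
have step c : (\int[P]_w (f w * val m c w * (ind m c w * W w))%:E)%E =
    (\int[P]_w (f w * val m c w * (D m c w * W' w))%:E)%E.
  have mfv : measurable_fun setT ((fun w => f w * val m c w) : OX -> R).
    exact: measurable_funM.
  have fv0 w : 0 <= f w * val m c w by rewrite mulr_ge0.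
  have := IH (b' c) _ mfv fv0.
  rewrite (_ : (\int[P]_w (f w * val m c w * (ind m c w * W w))%:E)%E =
    (\int[P]_w (f w * val m c w * \prod_(j < K)
       (if (j < m)%N then V j w else ind j (b' c j) w))%:E)%E); last first.
    apply: eq_integral => w _; congr (_ * _)%:E.
    rewrite [in RHS](bigD1 i0)//= ltnn {1}/b' eqxx; congr (_ * _).
    by apply: eq_bigr => j /(b'E c) ->.
  move=> ->; apply: eq_integral => w _; congr (_ * _)%:E.
  rewrite (bigD1 i0)//= ltnn {1}/b' eqxx; congr (_ * _).
  by apply: eq_bigr => j /(b'E c) ->.
transitivity ((\int[P]_w (f w * val m true w * (ind m true w * W w))%:E) +
  (\int[P]_w (f w * val m false w * (ind m false w * W w))%:E))%E.
  rewrite -ge0_integralD//.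
  - apply: eq_integral => w _; rewrite (bigD1 i0)//= ltnSn -EFinD; congr (_%:E).
    rewrite (_ : \prod_(i < K | i != i0) _ = W w); last by apply: eq_bigr => j /E ->.
    by rewrite /V /ind; case: asboolP => _ /=; ring.
  - by move=> w _; rewrite lee_fin !mulr_ge0.
  - apply/measurable_EFinP; apply: measurable_funM; apply: measurable_funM => //.
  - by move=> w _; rewrite lee_fin !mulr_ge0.
  - apply/measurable_EFinP; apply: measurable_funM; apply: measurable_funM => //.
rewrite !step -ge0_integralD//.
- apply: eq_integral => w _; rewrite [in RHS](bigD1 i0)//= ltnSn -EFinD; congr (_%:E).
  rewrite (_ : \prod_(i < K | i != i0) _ = W' w); last by apply: eq_bigr => j /E ->.
  by rewrite /u /D /val; ring.
- by move=> w _; rewrite lee_fin !mulr_ge0.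
- apply/measurable_EFinP; apply: measurable_funM; apply: measurable_funM => //.
- by move=> w _; rewrite lee_fin !mulr_ge0.
- apply/measurable_EFinP; apply: measurable_funM; apply: measurable_funM => //.
Qed.

Lemma los_integrated K :
  (\int[P]_w (\prod_(j < K) (if `[< L j w >] then fL (X j w) else fN (X j w)))%:E)%E =
  (\int[P]_w (\prod_(j < K) (lp beta (dist0 (X j w)) * fL (X j w) +
     (1 - lp beta (dist0 (X j w))) * fN (X j w)))%:E)%E.
Proof.
have := @los_induction K K (fun=> true) (cst 1) (@measurable_cst _ _ _ _ _ _) (fun=> ler01).
rewrite (_ : (\int[P]_w (cst 1 w * \prod_(j < K) (if (j < K)%N then V j w else ind j true w))%:E)%E =
  (\int[P]_w (\prod_(j < K) (if `[< L j w >] then fL (X j w) else fN (X j w)))%:E)%E); last first.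
  apply: eq_integral => w _; rewrite mul1r; congr (_%:E); apply: eq_bigr => j _.
  by rewrite ltn_ord /V /val; case: asboolP.
move=> ->; apply: eq_integral => w _; rewrite mul1r; congr (_%:E); apply: eq_bigr => j _.
by rewrite ltn_ord.
Qed.

End los.

(** * Laplace transform of the interference *)

Section model.
Context {d} {Om : measurableType d} {R : realType} (P : probability Om R).
Variables (X : nat -> Om -> R * R) (L : nat -> set Om) (h Mt : nat -> Om -> R)
  (h0 : Om -> R) (L0 : set Om).
Hypothesis mX : forall k, measurable_fun setT (X k).
Hypothesis mL : forall k, measurable (L k).
Hypothesis mh : forall k, measurable_fun setT (h k).
Hypothesis mMt : forall k, measurable_fun setT (Mt k).
Hypothesis mh0 : measurable_fun setT h0.
Hypothesis mL0 : measurable L0.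
Notation F := (model_sigma X L h Mt h0 L0).
Hypothesis hindep : mutually_indep P F.

Definition others (s : src) : set (set Om) :=
  \bigcup_(j in [set j | j <> s]) F j.
Notation OT s := (g_sigma_algebraType (others s)).

Let XL_sub : (\bigcup_k sigma_rv (X k)) `|` (\bigcup_k sigma_ev (L k)) `<=` measurable.
Proof.
move=> A [[k _]|[k _]]; first exact: sigma_rv_measurable.
exact: sigma_ev_measurable.
Qed.

Lemma model_sigma_measurable s : F s `<=` measurable.
Proof.
case: s => [|||k|k] /=.
- exact: g_sigma_algebra_sub.
- exact: sigma_rv_measurable.
- exact: sigma_ev_measurable.
- exact: sigma_rv_measurable.
- exact: sigma_rv_measurable.
Qed.

Lemma model_sigma_setI s : setI_closed (F s).
Proof.
case: s => [|||k|k] /=.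
- by move=> A B; exact: (@measurableI _ (g_sigma_algebraType _)).
- exact: sigma_rv_setI.
- exact: sigma_ev_setI.
- exact: sigma_rv_setI.
- exact: sigma_rv_setI.
Qed.

Lemma model_sigma_setT s : F s setT.
Proof.
case: s => [|||k|k] /=.
- exact: (@measurableT _ (g_sigma_algebraType _)).
- exact: sigma_rv_setT.
- exact: sigma_ev_setT.
- exact: sigma_rv_setT.
- exact: sigma_rv_setT.
Qed.

Lemma others_measurable s : <<s others s >> `<=` measurable.
Proof. by apply: g_sigma_algebra_sub => A [j _]; exact: model_sigma_measurable. Qed.

Lemma measurable_fun_others {d'} {T : measurableType d'} s (f : Om -> T) :
  measurable_fun setT (f : OT s -> T) -> measurable_fun setT f.
Proof. by move=> mf _ B mB; exact: others_measurable (mf measurableT B mB). Qed.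

Lemma indep_others s A B : F s A -> <<s others s >> B -> P (A `&` B) = (P A * P B)%E.
Proof.
exact: (mutually_indep_others model_sigma_measurable model_sigma_setI model_sigma_setT hindep).
Qed.

Lemma fubini_others {d1 d2} {T1 : measurableType d1} {T2 : measurableType d2} s
    (U : Om -> T1) (V : Om -> T2) (f : T1 * T2 -> \bar R) :
  sigma_rv U `<=` F s -> measurable_fun setT (V : OT s -> T2) ->
  measurable_fun setT f -> (forall x, 0 <= f x)%E ->
  (\int[P]_w f (U w, V w) = \int[P]_w \int[P]_w' f (U w', V w))%E.
Proof.
move=> sU mV mf f0; apply: indep_fubini => //.
- move=> _ B mB; rewrite setTI; apply: (@model_sigma_measurable s); apply: sU.
  by exists B.
- exact: measurable_fun_others mV.
- move=> A B mA mB; apply: (@indep_others s); first by apply: sU; exists A.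
  by have := mV measurableT B mB; rewrite setTI.
Qed.

Lemma others_model_sigma s j : j <> s -> F j `<=` <<s others s >>.
Proof. by move=> js A FA; apply: sub_sigma_algebra; exists j. Qed.

Lemma others_rv {d'} {T : measurableType d'} s j (f : Om -> T) : j <> s ->
  sigma_rv f `<=` F j -> measurable_fun setT (f : OT s -> T).
Proof.
move=> js sf _ B mB; rewrite setTI; apply: (others_model_sigma js); apply: sf.
by exists B.
Qed.

Lemma others_X s k : sXL <> s -> measurable_fun setT (X k : OT s -> R * R).
Proof.
move=> sn; apply: (others_rv sn) => A sA.
by apply: sub_sigma_algebra; left; exists k.
Qed.

Lemma others_L s k : sXL <> s -> measurable (L k : set (OT s)).
Proof.
move=> sn; apply: (others_model_sigma sn); apply: sub_sigma_algebra; right.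
by exists k => //; right; left.
Qed.


Variables (n : nat) (Pt A G g alphaL alphaN theta t : R).
Hypotheses (n0 : (0 < n)%N) (Pt0 : 0 < Pt) (A0 : 0 < A) (G0 : 0 < G) (g0 : 0 < g)
  (t0 : 0 < t).
Hypothesis hh : forall k, has_gamma_law P n.+1 (n.+1%:R)^-1 (h k).
Hypothesis h_ge0 : forall k w, 0 <= h k w.
Let p0 : R := (theta / pi) ^+ 2.
Let p1 : R := 2 * (theta / pi) * ((pi - theta) / pi).
Let p2 : R := ((pi - theta) / pi) ^+ 2.
Hypothesis hM : forall k, P (Mt k @^-1` [set 0]) = p0%:E /\
  P (Mt k @^-1` [set 1]) = p1%:E /\ P (Mt k @^-1` [set 2]) = p2%:E.

Definition pathloss k w : R :=
  dist0 (X k w) `^ (- (if `[< L k w >] then alphaL else alphaN)).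

Definition mark_exp k w : R :=
  expR (- (t * (Pt * gain G g (Mt k w) * h k w * A * pathloss k w))).

(** Laplace transform at [t] of the power received from one point, averaged over its fading, for
    gain [c] and path loss [x]. The real power allows [measurable_fun_powRl] to apply. *)
Definition fading_laplace (c x : R) : R :=
  (1 + t * Pt * A * c * x / n.+1%:R) `^ (- n.+1%:R).

Definition mark_laplace (x : R) : R :=
  p0 * fading_laplace (G * G) x + p1 * fading_laplace (G * g) x +
  p2 * fading_laplace (g * g) x.

Lemma integral_gain k (phi : R -> R) : (forall x, 0 <= phi x) ->
  (\int[P]_w (phi (gain G g (Mt k w)))%:E)%E =
  (p0 * phi (G * G) + p1 * phi (G * g) + p2 * phi (g * g))%:E.
Proof.
move=> phi0; have [M0 [M1 M2]] := hM k.
set E0 := Mt k @^-1` [set 0]; set E1 := Mt k @^-1` [set 1].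
have mE (x : R) : measurable (Mt k @^-1` [set x]).
  by rewrite -[X in measurable X]setTI; exact: (mMt k).
have mE0 : measurable E0 by exact: mE.
have mE1 : measurable E1 by exact: mE.
(* [gain] assigns [g * g] to every mark other than 0 and 1, so the third event is a complement; its
   probability is [p2] because the three weights sum to 1. *)
have mE2 : measurable (~` (E0 `|` E1)) by apply: measurableC; exact: measurableU.
have PE2 : P (~` (E0 `|` E1)) = p2%:E.
  rewrite probability_setC; last exact: measurableU.
  have dE : E0 `&` E1 = set0.
    apply/seteqP; split => // w [Mw0 Mw1].
    have : 1 = 0 :> R by apply: (etrans (esym (Mw1 : Mt k w = 1))); exact: Mw0.
    by move/eqP; rewrite oner_eq0.
  have -> : P (E0 `|` E1) = (p0 + p1)%:E.
    apply: (etrans (measureU P mE0 mE1 dE)).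
    by rewrite EFinD; congr (_ + _)%E; [exact: M0|exact: M1].
  rewrite -EFinB; congr (_%:E).
  rewrite /p0 /p1 /p2; have := @pi_gt0 R; move: (@pi R) => q q0.
  by field; rewrite gt_eqF.
transitivity (\int[P]_w ((phi (G * G))%:E * (\1_E0 w)%:E + (phi (G * g))%:E * (\1_E1 w)%:E +
   (phi (g * g))%:E * (\1_(~` (E0 `|` E1)) w)%:E))%E.
  apply: eq_integral => w _; rewrite !indicE in_setC in_setU.
  have -> : (w \in E0) = (Mt k w == 0) by apply/idP/eqP => [/set_mem//|]; exact: mem_set.
  have -> : (w \in E1) = (Mt k w == 1) by apply/idP/eqP => [/set_mem//|]; exact: mem_set.
  rewrite /gain; have [->|M0'] := eqVneq (Mt k w) 0.
    by rewrite eq_sym oner_eq0/= mule1 !mule0 !adde0.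
  by have [M1'|M1'] := eqVneq (Mt k w) 1; rewrite /= ?mule1 ?mule0 ?adde0 ?add0e.
have mi (B : set Om) (c : R) : measurable B ->
    measurable_fun setT (fun w => c%:E * (\1_B w)%:E)%E.
  by move=> mB; apply: measurable_funeM; apply/measurable_EFinP; exact: measurable_indic.
have ge (B : set Om) (c : R) w : 0 <= c -> (0 <= c%:E * (\1_B w)%:E)%E.
  by move=> c0; rewrite mule_ge0// lee_fin.
have ii (B : set Om) (c q : R) : measurable B -> 0 <= c -> P B = q%:E ->
    (\int[P]_w (c%:E * (\1_B w)%:E))%E = (q * c)%:E.
  move=> mB c0 PB; rewrite ge0_integralZl//.
  - transitivity (c%:E * q%:E)%E; last by rewrite -EFinM mulrC.
    by congr (_ * _)%E; rewrite integral_indic// setIT; exact: PB.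
  - by apply/measurable_EFinP; exact: measurable_indic.
rewrite ge0_integralD//.
- rewrite ge0_integralD//.
  + by rewrite (ii _ _ p0)// (ii _ _ p1)// (ii _ _ p2).
  + by move=> w _; exact: ge.
  + exact: mi.
  + by move=> w _; exact: ge.
  + exact: mi.
- by move=> w _; rewrite adde_ge0// ge.
- by apply: emeasurable_funD; exact: mi.
- by move=> w _; exact: ge.
- exact: mi.
Qed.

Lemma pathloss_ge0 k w : 0 <= pathloss k w.
Proof. exact: powR_ge0. Qed.

Lemma measurable_fading_laplace c : measurable_fun setT (fading_laplace c).
Proof.
apply: measurable_fun_powRl.
apply: measurable_funD => //; apply: measurable_funM => //.
Qed.

Lemma measurable_mark_laplace : measurable_fun setT mark_laplace.
Proof.
apply: measurable_funD; last first.
  by apply: measurable_funM => //; exact: measurable_fading_laplace.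
by apply: measurable_funD; apply: measurable_funM => //; exact: measurable_fading_laplace.
Qed.

Lemma others_pathloss s k : sXL <> s -> measurable_fun setT (pathloss k : OT s -> R).
Proof.
move=> sn.
rewrite (_ : pathloss k = fun w => if `[< L k w >] then dist0 (X k w) `^ (- alphaL)
  else dist0 (X k w) `^ (- alphaN)); last first.
  by apply/funext => w; rewrite /pathloss; case: asboolP.
have mXd : measurable_fun setT (fun w : OT s => dist0 (X k w)).
  by apply: (measurableT_comp measurable_dist0); exact: others_X.
apply: (@measurable_fun_if_set _ _ (OT s) R).
- exact: others_L.
- exact: (@measurable_fun_powRl _ (OT s)).
- exact: (@measurable_fun_powRl _ (OT s)).
Qed.

Lemma others_gain s k : sM k <> s ->
  measurable_fun setT (fun w : OT s => gain G g (Mt k w)).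
Proof.
move=> sn; apply: (measurableT_comp (measurable_gain _ _)).
by apply: (others_rv sn).
Qed.

Lemma others_mark_exp s k : sXL <> s -> sH k <> s -> sM k <> s ->
  measurable_fun setT (mark_exp k : OT s -> R).
Proof.
move=> s1 s2 s3; rewrite /mark_exp; apply: (measurableT_comp (@measurable_expR R)).
apply: measurable_funN; apply: measurable_funM => //.
apply: measurable_funM; last exact: others_pathloss.
apply: measurable_funM => //; apply: measurable_funM; last by apply: (others_rv s2).
by apply: measurable_funM => //; exact: others_gain.
Qed.

(** Fubini is applied twice: first the fading of point [k] is integrated with everything else
    frozen, then its gain. Hence [W] must be measurable for the sources other than [sH k] and for
    those other than [sM k]. *)
Lemma mark_step k (W : Om -> R) : (forall w, 0 <= W w) ->
  measurable_fun setT (W : OT (sH k) -> R) ->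
  measurable_fun setT (W : OT (sM k) -> R) ->
  (\int[P]_w (mark_exp k w * W w)%:E)%E =
  (\int[P]_w (mark_laplace (pathloss k w) * W w)%:E)%E.
Proof.
move=> W0 mWH mWM.
pose c w := t * Pt * A * gain G g (Mt k w) * pathloss k w.
have c_ge0 w : 0 <= c w.
  by rewrite !mulr_ge0 ?(ltW t0) ?(ltW Pt0) ?(ltW A0) ?gain_ge0 ?pathloss_ge0.
(* The absolute value makes the integrand nonnegative on the whole space, as Fubini requires; it
   disappears on the values of [W]. *)
pose f1 (z : R * (R * R)) : \bar R := (expR (- (z.2.1 * z.1)) * `|z.2.2|)%:E.
have mf1 : measurable_fun setT f1.
  apply/measurable_EFinP; apply: measurable_funM.
    apply: (measurableT_comp (@measurable_expR R)); apply: measurable_funN.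
    apply: measurable_funM; last exact: measurable_fst.
    exact: (measurableT_comp measurable_fst measurable_snd).
  apply: (measurableT_comp (@normr_measurable R setT)).
  exact: (measurableT_comp measurable_snd measurable_snd).
have f1_ge0 z : (0 <= f1 z)%E by rewrite lee_fin mulr_ge0 ?expR_ge0.
have mV1 : measurable_fun setT ((fun w => (c w, W w)) : OT (sH k) -> R * R).
  apply: measurable_fun_pair => //.
  apply: measurable_funM; last exact: others_pathloss.
  by apply: measurable_funM => //; exact: others_gain.
have E1 := @fubini_others _ _ _ _ (sH k) (h k) _ f1 (fun _ => id) mV1 mf1 f1_ge0.
pose f2 (z : R * (R * R)) : \bar R :=
  (fading_laplace (gain G g z.1) z.2.1 * `|z.2.2|)%:E.
have mf2 : measurable_fun setT f2.
  apply/measurable_EFinP; apply: measurable_funM.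
    apply: measurable_fun_powRl.
    apply: measurable_funD => //; apply: measurable_funM => //.
    apply: measurable_funM.
      apply: measurable_funM => //.
      exact: (measurableT_comp (measurable_gain _ _) measurable_fst).
    exact: (measurableT_comp measurable_fst measurable_snd).
  apply: (measurableT_comp (@normr_measurable R setT)).
  exact: (measurableT_comp measurable_snd measurable_snd).
have f2_ge0 z : (0 <= f2 z)%E by rewrite lee_fin mulr_ge0 ?powR_ge0.
have mV2 : measurable_fun setT ((fun w => (pathloss k w, W w)) : OT (sM k) -> R * R).
  by apply: measurable_fun_pair => //; exact: others_pathloss.
have E2 := @fubini_others _ _ _ _ (sM k) (Mt k) _ f2 (fun _ => id) mV2 mf2 f2_ge0.
transitivity (\int[P]_w f1 (h k w, (c w, W w)))%E.
  apply: eq_integral => w _; rewrite /f1/= (ger0_norm (W0 w)); congr (_ * _)%:E.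
  by congr (expR (- _)); rewrite /c; ring.
rewrite E1.
transitivity (\int[P]_w f2 (Mt k w, (pathloss k w, W w)))%E.
  apply: eq_integral => w _; rewrite /f1 /f2/=.
  under eq_integral do rewrite EFinM.
  rewrite ge0_integralZr//.
  - rewrite (gamma_law_laplace (hh k) n0 (c_ge0 w)) -EFinM; congr (_ * _)%:E.
    rewrite /fading_laplace powR_invn// addr_ge0// divr_ge0//; exact: c_ge0.
  - apply/measurable_EFinP; apply: (measurableT_comp (@measurable_expR R)).
    by apply: measurable_funN; exact: measurable_funM.
rewrite E2; apply: eq_integral => w _; rewrite /f2/=.
under eq_integral do rewrite EFinM.
rewrite ge0_integralZr//.
- rewrite (@integral_gain k (fun y => fading_laplace y (pathloss k w))).
    by rewrite -EFinM ger0_norm.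
  by move=> y; exact: powR_ge0.
- apply/measurable_EFinP; apply: measurable_fun_powRl.
  apply: measurable_funD => //; apply: measurable_funM => //.
  apply: measurable_funM => //; apply: measurable_funM => //.
  exact: (measurableT_comp (measurable_gain _ _)).
- by move=> w' _; rewrite lee_fin powR_ge0.
Qed.

Lemma mark_laplace_ge0 x : 0 <= theta <= pi -> 0 <= mark_laplace x.
Proof.
move=> /andP[th0 th1].
have q0 : 0 <= theta / pi by rewrite divr_ge0// pi_ge0.
have q1 : 0 <= (pi - theta) / pi by rewrite divr_ge0 ?subr_ge0// pi_ge0.
have p1_ge0 : 0 <= p1 by apply: mulr_ge0 q1; exact: mulr_ge0.
by apply: addr_ge0; [apply: addr_ge0|]; apply: mulr_ge0; rewrite ?powR_ge0 ?exprn_ge0.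
Qed.

Lemma marks_integrated K m : 0 <= theta <= pi ->
  (\int[P]_w (\prod_(k < K) mark_exp k w)%:E)%E =
  (\int[P]_w (\prod_(k < K)
     (if (k < m)%N then mark_laplace (pathloss k w) else mark_exp k w))%:E)%E.
Proof.
move=> th; elim: m => [//|m ->].
have [Km|mK] := leqP K m.
  apply: eq_integral => w _; congr (_%:E); apply: eq_bigr => k _.
  by rewrite (leq_trans (ltn_ord k) Km) ltnS ltnW// (leq_trans (ltn_ord k) Km).
pose i0 := Ordinal mK.
have E (i : 'I_K) : i != i0 -> (i < m.+1)%N = (i < m)%N.
  by move=> ii0; rewrite ltnS leq_eqVlt orb_idl// => /eqP ik; case/eqP: ii0; exact/val_inj.
pose W w := \prod_(k < K | k != i0)
  (if (k < m)%N then mark_laplace (pathloss k w) else mark_exp k w).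
have W0 w : 0 <= W w.
  by apply: prodr_ge0 => k _; case: ifPn => _; rewrite ?mark_laplace_ge0 ?expR_ge0.
(* The factor of index [m] is left out, so [W] involves neither [h m] nor [Mt m]. *)
have mW s : sXL <> s -> (forall j, j <> m -> sH j <> s /\ sM j <> s) ->
    measurable_fun setT (W : OT s -> R).
  move=> sX sj.
  rewrite (_ : W = fun w => \prod_(k < K) (if k != i0 then
    (if (k < m)%N then mark_laplace (pathloss k w) else mark_exp k w) else 1)); last first.
    by apply/funext => w; rewrite /W big_mkcond.
  apply: (@measurable_prod _ (OT s)) => k _.
  case: (eqVneq k i0) => // ki0.
  case: (k < m)%N.
    by apply: (measurableT_comp measurable_mark_laplace); exact: others_pathloss.
  have [|s1 s2] := sj k; first by move=> km; case/eqP: ki0; exact: val_inj.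
  exact: others_mark_exp.
transitivity (\int[P]_w (mark_exp m w * W w)%:E)%E.
  by apply: eq_integral => w _; rewrite (bigD1 i0)//= ltnn.
rewrite mark_step//.
- apply: eq_integral => w _; rewrite [in RHS](bigD1 i0)//= ltnSn; congr (_ * _)%:E.
  by apply: eq_bigr => k /E ->.
- by apply: mW => // j jm; split => // -[].
- by apply: mW => // j jm; split => // -[].
Qed.


Variables (beta lam : R).
Hypotheses (beta0 : 0 < beta) (lam0 : 0 < lam) (theta0 : 0 < theta) (theta1 : theta <= pi).
Hypotheses (hX : is_PPP P lam X) (hL : los_marks P beta X L).

Definition point_laplace (p : R * R) : R :=
  lp beta (dist0 p) * mark_laplace (dist0 p `^ (- alphaL)) +
  (1 - lp beta (dist0 p)) * mark_laplace (dist0 p `^ (- alphaN)).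

Let p012 : p0 + p1 + p2 = 1.
Proof.
rewrite /p0 /p1 /p2; have := @pi_gt0 R; move: (@pi R) => q q0.
by field; rewrite gt_eqF.
Qed.

Let q0 : 0 < theta / pi.
Proof. by rewrite divr_gt0// pi_gt0. Qed.

Let q1 : 0 <= (pi - theta) / pi.
Proof. by rewrite divr_ge0 ?subr_ge0// pi_ge0. Qed.

Let p0_gt0 : 0 < p0.
Proof. exact: exprn_gt0. Qed.

Let p1_ge0 : 0 <= p1.
Proof. by apply: mulr_ge0 q1; apply: mulr_ge0 => //; exact: ltW. Qed.

Let p2_ge0 : 0 <= p2.
Proof. exact: exprn_ge0. Qed.

Lemma fading_laplace_bounds c x : 0 <= c -> 0 <= x -> 0 < fading_laplace c x <= 1.
Proof.
move=> c0 x0; rewrite /fading_laplace.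
have a0 : 0 <= t * Pt * A * c * x / n.+1%:R.
  by rewrite !mulr_ge0 ?invr_ge0// ltW.
have a1 : 1 <= 1 + t * Pt * A * c * x / n.+1%:R by rewrite lerDl.
have a2 : 0 < 1 + t * Pt * A * c * x / n.+1%:R by exact: lt_le_trans a1.
by rewrite powR_gt0//= powR_invn ?(ltW a2)// invf_le1 ?exprn_gt0// exprn_ege1.
Qed.

Lemma mark_laplace_bounds x : 0 <= x -> 0 < mark_laplace x <= 1.
Proof.
move=> x0; rewrite /mark_laplace.
have /andP[a0 a1] := @fading_laplace_bounds (G * G) x (mulr_ge0 (ltW G0) (ltW G0)) x0.
have /andP[b0 b1] := @fading_laplace_bounds (G * g) x (mulr_ge0 (ltW G0) (ltW g0)) x0.
have /andP[c0 c1] := @fading_laplace_bounds (g * g) x (mulr_ge0 (ltW g0) (ltW g0)) x0.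
apply/andP; split.
  apply: ltr_pwDl; last by rewrite mulr_ge0// ltW.
  by apply: ltr_pwDl; [exact: mulr_gt0|rewrite mulr_ge0// ltW].
rewrite -p012; apply: lerD; first apply: lerD.
- by rewrite ler_piMr// ltW.
- by rewrite ler_piMr.
- by rewrite ler_piMr.
Qed.

(** Positivity allows a logarithm to be taken, and the bound 1 makes [- ln (point_laplace p)]
    nonnegative: the Laplace functional can be applied to it. *)
Lemma point_laplace_bounds p : 0 < point_laplace p <= 1.
Proof.
have /andP[a0 a1] := mark_laplace_bounds (powR_ge0 (dist0 p) (- alphaL)).
have /andP[b0 b1] := mark_laplace_bounds (powR_ge0 (dist0 p) (- alphaN)).
have l0 : 0 < lp beta (dist0 p) by exact: expR_gt0.
have l1 : lp beta (dist0 p) <= 1 by exact/lp_le1/dist0_ge0.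
rewrite /point_laplace; apply/andP; split.
  by rewrite ltr_pwDl ?mulr_gt0// mulr_ge0 ?subr_ge0// ltW.
rewrite [leRHS](_ : 1 = lp beta (dist0 p) * 1 + (1 - lp beta (dist0 p)) * 1); last by ring.
by apply: lerD; apply: ler_wpM2l => //; rewrite ?subr_ge0// ltW.
Qed.

Let measurable_mark_dist al : measurable_fun setT (fun p : R * R => mark_laplace (dist0 p `^ (- al))).
Proof.
apply: (measurableT_comp measurable_mark_laplace).
by apply: measurable_fun_powRl; exact: measurable_dist0.
Qed.

Lemma measurable_point_laplace : measurable_fun setT point_laplace.
Proof.
have ml : measurable_fun setT (fun p : R * R => lp beta (dist0 p)).
  exact: (measurableT_comp (@measurable_lp R beta) measurable_dist0).
by apply: measurable_funD; apply: measurable_funM => //; exact: measurable_funB.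
Qed.

Lemma partial_laplace K :
  (\int[P]_w (\prod_(k < K) mark_exp k w)%:E)%E =
  (\int[P]_w (\prod_(k < K) point_laplace (X k w))%:E)%E.
Proof.
have th : 0 <= theta <= pi by rewrite ltW.
rewrite (marks_integrated K K th).
transitivity (\int[P]_w (\prod_(k < K) (if `[< L k w >] then
    mark_laplace (dist0 (X k w) `^ (- alphaL)) else
    mark_laplace (dist0 (X k w) `^ (- alphaN))))%:E)%E.
  apply: eq_integral => w _; congr (_%:E); apply: eq_bigr => k _.
  by rewrite ltn_ord /pathloss; case: asboolP.
rewrite (@los_integrated _ _ _ P beta X L mX hL beta0
  (fun p => mark_laplace (dist0 p `^ (- alphaL)))
  (fun p => mark_laplace (dist0 p `^ (- alphaN))))//.
- by move=> p; exact: mark_laplace_ge0.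
- by move=> p; exact: mark_laplace_ge0.
Qed.

Lemma cvg_integral_prod_expR (a : nat -> Om -> R) :
  (forall k, measurable_fun setT (a k)) -> (forall k w, 0 <= a k w) ->
  (\int[P]_w (\prod_(k < K) expR (- a k w))%:E)%E @[K --> \oo] -->
  (\int[P]_w (expN (\sum_(0 <= k <oo) (a k w)%:E))%:E)%E.
Proof.
move=> ma a0.
have aE K w : \prod_(k < K) expR (- a k w) = expN (\sum_(0 <= k < K) (a k w)%:E)%E.
  rewrite expN_sum; first by rewrite big_mkord.
  by move=> k; rewrite lee_fin.
apply: bounded_cvg_integral.
- by move=> K; apply: measurable_prod => k _; apply: measurableT_comp => //; exact: measurable_funN.
- move=> K w; rewrite aE expN_ge0 expN_le1//.
  by apply: sume_ge0 => k _; rewrite lee_fin.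
- move=> w; under eq_fun do rewrite aE.
  apply: cvg_expN; first by move=> K; apply: sume_ge0 => k _; rewrite lee_fin.
  by apply: is_cvg_nneseries => k _ _; rewrite lee_fin.
Qed.

Lemma measurable_pathloss k : measurable_fun setT (pathloss k).
Proof. by apply: (@measurable_fun_others _ _ sH0); exact: others_pathloss. Qed.

(** By [partial_laplace], the products over the first [K] points for the true marks and for
    [f = - ln point_laplace] have the same mean. The two limits in [K] are the transform of the
    interference and the Laplace functional of [f], hence equal. *)
Lemma interference_laplace :
  (\int[@lebesgue_measure R \x @lebesgue_measure R]_p (1 - point_laplace p)%:E < +oo)%E ->
  (\int[P]_w (expN (t%:E * interference Pt A G g alphaL alphaN X L h Mt w)%E)%:E)%E =
  (expR (- (lam * fine (\int[@lebesgue_measure R \x @lebesgue_measure R]_p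
     (1 - point_laplace p)%:E)%E)))%:E.
Proof.
move=> Ioo.
pose f p := - ln (point_laplace p).
have f0 p : 0 <= f p.
  by rewrite oppr_ge0 ln_le0//; case/andP: (point_laplace_bounds p).
have fE p : expR (- f p) = point_laplace p.
  by rewrite opprK lnK// posrE; case/andP: (point_laplace_bounds p).
have mf : measurable_fun setT f.
  apply: measurable_funN; apply: (measurableT_comp (@measurable_ln R)).
  exact: measurable_point_laplace.
pose z k w := t * (Pt * gain G g (Mt k w) * h k w * A * pathloss k w).
have z0 k w : 0 <= z k w.
  by rewrite !mulr_ge0 ?(ltW t0) ?(ltW Pt0) ?(ltW A0) ?gain_ge0 ?pathloss_ge0.
have mz k : measurable_fun setT (z k).
  apply: measurable_funM => //; apply: measurable_funM; last exact: measurable_pathloss.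
  apply: measurable_funM => //; apply: measurable_funM => //; apply: measurable_funM => //.
  exact: (measurableT_comp (measurable_gain _ _)).
have H1 := cvg_integral_prod_expR mz z0.
have H2 := @cvg_integral_prod_expR (fun k w => f (X k w))
  (fun k => measurableT_comp mf (mX k)) (fun k w => f0 (X k w)).
have E12 : (fun K => \int[P]_w (\prod_(k < K) expR (- z k w))%:E)%E =
    (fun K => \int[P]_w (\prod_(k < K) expR (- f (X k w)))%:E)%E.
  apply/funext => K; rewrite -[LHS]/(\int[P]_w (\prod_(k < K) mark_exp k w)%:E)%E.
  rewrite partial_laplace; apply: eq_integral => w _; congr (_%:E).
  by apply: eq_bigr => k _; rewrite fE.
have E3 : (\int[@lebesgue_measure R \x @lebesgue_measure R]_p (1 - expR (- f p))%:E =
    \int[@lebesgue_measure R \x @lebesgue_measure R]_p (1 - point_laplace p)%:E)%E.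
  by apply: eq_integral => p _; rewrite fE.
have E4 := ppp_laplace lam0 hX mf f0; rewrite E3 in E4.
rewrite -(E4 Ioo) -(cvg_unique _ (eq_ind _ (fun u => u K @[K --> \oo] --> _) H1 _ E12) H2)//.
apply: eq_integral => w _; congr (expN _)%:E.
rewrite /interference -nneseriesZl; last first.
  move=> k _; rewrite lee_fin; have := z0 k w.
  by rewrite /z pmulr_rge0.
by apply: eq_eseriesr => k _; rewrite EFinM.
Qed.

End model.

(** * The integrals kappa and xi *)

Section kappa.
Context {R : realType}.
Variables (n : nat) (G g theta beta T : R).
Hypotheses (G0 : 0 < G) (g0 : 0 < g) (beta0 : 0 < beta) (theta0 : 0 < theta)
  (theta1 : theta <= pi) (T0 : 0 < T).
Notation mR := (measurableTypeR R).
Notation leb := (@lebesgue_measure R).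
Let p0 : R := (theta / pi) ^+ 2.
Let p1 : R := 2 * (theta / pi) * ((pi - theta) / pi).
Let p2 : R := ((pi - theta) / pi) ^+ 2.
Let pos : set mR := [set x : R | 0 <= x].

Let mpos : measurable pos.
Proof.
rewrite (_ : pos = `[0, +oo[%classic) //.
by apply/seteqP; split => x /=; rewrite in_itv/= andbT.
Qed.

Let q0 : 0 <= theta / pi.
Proof. by rewrite divr_ge0 ?ltW// pi_gt0. Qed.

Let q1 : 0 <= (pi - theta) / pi.
Proof. by rewrite divr_ge0 ?subr_ge0// pi_ge0. Qed.

Let p0_ge0 : 0 <= p0.
Proof. exact: exprn_ge0. Qed.

Let p1_ge0 : 0 <= p1.
Proof. by apply: mulr_ge0 q1; exact: mulr_ge0. Qed.

Let p2_ge0 : 0 <= p2.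
Proof. exact: exprn_ge0. Qed.

Let lo (los : bool) x := if los then lp beta x else 1 - lp beta x.

(** The integrand of [intf], with a factor [x ^ (- alpha)] instead of a division, in the shape of
    [fading_laplace]. *)
Definition ring_loss (c alpha : R) (los : bool) (x : R) : R :=
  (1 - (1 + c * x `^ (- alpha) / n.+1%:R) `^ (- n.+1%:R)) * lo los x * x.

Lemma ring_loss_ge0 c alpha los x : 0 <= c -> 0 <= x -> 0 <= ring_loss c alpha los x.
Proof.
move=> c0 x0; rewrite /ring_loss; apply: mulr_ge0 => //; apply: mulr_ge0.
  have a0 : 0 <= c * x `^ (- alpha) / n.+1%:R.
    by rewrite !mulr_ge0 ?powR_ge0 ?invr_ge0.
  have a1 : 1 <= 1 + c * x `^ (- alpha) / n.+1%:R by rewrite lerDl.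
  have a2 : 0 < 1 + c * x `^ (- alpha) / n.+1%:R by exact: lt_le_trans a1.
  by rewrite subr_ge0 powR_invn ?(ltW a2)// invf_le1 ?exprn_gt0// exprn_ege1.
by rewrite /lo; case: los; rewrite ?expR_ge0// subr_ge0 lp_le1.
Qed.

Lemma measurable_ring_loss c alpha los : measurable_fun setT (ring_loss c alpha los).
Proof.
apply: measurable_funM => //; apply: measurable_funM.
  apply: measurable_funB => //; apply: measurable_fun_powRl.
  apply: measurable_funD => //; apply: measurable_funM => //; apply: measurable_funM => //.
rewrite /lo; case: los; first exact: measurable_lp.
by apply: measurable_funB => //; exact: measurable_lp.
Qed.

Let measurable_ring_loss' c alpha los :
  @measurable_fun _ _ mR _ pos (fun x => (ring_loss c alpha los x)%:E).
Proof.
have mr : @measurable_fun _ _ mR R setT (ring_loss c alpha los).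
  exact: measurable_ring_loss.
by apply/measurable_EFinP; exact: measurable_funTS.
Qed.

Lemma intf_ring_loss c alpha los : 0 <= c ->
  intf n.+1 c alpha beta los = (\int[leb]_(x in pos) (ring_loss c alpha los x)%:E)%E.
Proof.
move=> c0; apply: eq_integral => x; rewrite inE/= => x0; congr (_%:E).
have a0 : 0 <= c * x `^ (- alpha) / n.+1%:R.
  by rewrite !mulr_ge0 ?powR_ge0 ?invr_ge0.
rewrite /ring_loss powR_invn; last by rewrite addr_ge0.
by rewrite powRN invfM mulrA.
Qed.

Lemma kap_ring_loss q alpha los (k : nat) : 0 <= q ->
  kap n.+1 G g theta q alpha beta los k T =
  (\int[leb]_(x in pos)
    (p0 * ring_loss (k%:R * (q * (G * G) / (G * G)) * T) alpha los x +
     p1 * ring_loss (k%:R * (q * (G * g) / (G * G)) * T) alpha los x +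
     p2 * ring_loss (k%:R * (q * (g * g) / (G * G)) * T) alpha los x)%:E)%E.
Proof.
move=> qge0.
have c_ge0 c : 0 <= c -> 0 <= k%:R * (q * c / (G * G)) * T.
  move=> c0; rewrite !mulr_ge0 ?invr_ge0 ?(ltW T0)//.
  by rewrite mulr_ge0 ?ltW.
have r0 c x : 0 <= c -> pos x ->
    (0 <= (ring_loss (k%:R * (q * c / (G * G)) * T) alpha los x)%:E)%E.
  by move=> c0 x0; rewrite lee_fin ring_loss_ge0// c_ge0.
have cGG : 0 <= G * G by rewrite mulr_ge0 ?ltW.
have cGg : 0 <= G * g by rewrite mulr_ge0 ?ltW.
have cgg : 0 <= g * g by rewrite mulr_ge0 ?ltW.
rewrite /kap !intf_ring_loss ?c_ge0// -/p0 -/p1 -/p2.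
rewrite -!ge0_integralZl//.
- rewrite -ge0_integralD//.
  + rewrite -ge0_integralD//.
    * by move=> x x0; rewrite adde_ge0// mule_ge0// r0.
    * by apply: emeasurable_funD; exact: measurable_funeM.
    * by move=> x x0; rewrite mule_ge0// r0.
    * exact: measurable_funeM.
  + by move=> x x0; rewrite mule_ge0// r0.
  + exact: measurable_funeM.
  + by move=> x x0; rewrite mule_ge0// r0.
  + exact: measurable_funeM.
- by move=> x x0; exact: r0.
- by move=> x x0; exact: r0.
- by move=> x x0; exact: r0.
Qed.

Lemma kap_ge0 q alpha los (k : nat) : 0 <= q ->
  (0 <= kap n.+1 G g theta q alpha beta los k T)%E.
Proof.
move=> qge0; rewrite kap_ring_loss//; apply: integral_ge0 => x x0; rewrite lee_fin.
have c_ge0 c : 0 <= c -> 0 <= k%:R * (q * c / (G * G)) * T.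
  move=> c0; rewrite !mulr_ge0 ?invr_ge0 ?(ltW T0)//.
  by rewrite mulr_ge0 ?ltW.
by apply: addr_ge0; [apply: addr_ge0|]; apply: mulr_ge0 => //; apply: ring_loss_ge0 => //;
  apply: c_ge0; rewrite mulr_ge0 ?ltW.
Qed.

Variables (Pt A alphaL alphaN t : R).
Hypotheses (Pt0 : 0 < Pt) (A0 : 0 < A) (t0 : 0 < t).

(** The equation on [t] is the relation between a Laplace point and the parameter [k * Q * T] of the
    integrals; the factor [2 * pi] comes from polar coordinates. *)
Lemma integral_point_laplace q (k : nat) : 0 <= q ->
  t * Pt * A = k%:R * (q / (G * G)) * T ->
  (\int[leb \x leb]_p (1 - point_laplace n Pt A G g alphaL alphaN theta t beta p)%:E)%E =
  ((2 * pi)%:E * (kap n.+1 G g theta q alphaL beta true k T +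
                  kap n.+1 G g theta q alphaN beta false k T))%E.
Proof.
move=> qge0 tE.
pose ul (x : R) := lp beta x * mark_laplace n Pt A G g theta t (x `^ (- alphaL)) +
  (1 - lp beta x) * mark_laplace n Pt A G g theta t (x `^ (- alphaN)).
have mml := @measurable_mark_laplace R n Pt A G g theta t.
have mul : measurable_fun setT ul.
  have mlp := @measurable_lp R beta.
  apply: measurable_funD; apply: measurable_funM => //.
  - by apply: (measurableT_comp mml); exact: measurable_fun_powRl.
  - exact: measurable_funB.
  - by apply: (measurableT_comp mml); exact: measurable_fun_powRl.
(* [integral_dist0] requires nonnegativity on the whole line, but [ul <= 1] is only available for
   [x >= 0], since [lp beta x] exceeds 1 for negative [x]. *)
have H := @integral_dist0 R (fun x => `|1 - ul x|%:E).
transitivity (\int[leb \x leb]_p (`|1 - ul (dist0 p)|%:E))%E.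
  apply: eq_integral => p _; rewrite ger0_norm// subr_ge0.
  have := @point_laplace_bounds R n Pt A G g alphaL alphaN theta t Pt0 A0 G0 g0 t0 beta beta0 theta0 theta1 p.
  by case/andP.
rewrite H; last 2 first.
- apply/measurable_EFinP; apply: (measurableT_comp (@normr_measurable R setT)).
  exact: measurable_funB.
- by move=> x; rewrite lee_fin.
rewrite !kap_ring_loss//.
pose J alpha los x := p0 * ring_loss (k%:R * (q * (G * G) / (G * G)) * T) alpha los x +
  p1 * ring_loss (k%:R * (q * (G * g) / (G * G)) * T) alpha los x +
  p2 * ring_loss (k%:R * (q * (g * g) / (G * G)) * T) alpha los x.
have c_ge0 c : 0 <= c -> 0 <= k%:R * (q * c / (G * G)) * T.
  move=> c0; rewrite !mulr_ge0 ?invr_ge0 ?(ltW T0)//.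
  by rewrite mulr_ge0 ?ltW.
have J0 alpha los x : pos x -> (0 <= (J alpha los x)%:E)%E.
  move=> x0; rewrite lee_fin /J.
  by apply: addr_ge0; [apply: addr_ge0|]; apply: mulr_ge0 => //; apply: ring_loss_ge0 => //;
    apply: c_ge0; rewrite mulr_ge0 ?ltW.
have mJ alpha los : @measurable_fun _ _ mR _ pos (fun x => (J alpha los x)%:E).
  have mj : @measurable_fun _ _ mR R setT (J alpha los).
    by apply: measurable_funD; [apply: measurable_funD|]; apply: measurable_funM => //;
      exact: measurable_ring_loss.
  by apply/measurable_EFinP; exact: measurable_funTS.
have pi0 : 0 <= 2 * pi :> R by rewrite mulr_ge0// pi_ge0.
transitivity ((2 * pi)%:E * (\int[leb]_(x in pos) (J alphaL true x)%:E +
  \int[leb]_(x in pos) (J alphaN false x)%:E))%E => //.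
rewrite -ge0_integralD//; last 2 first.
- by move=> x x0; exact: J0.
- by move=> x x0; exact: J0.
rewrite -ge0_integralZl//; last 2 first.
- exact: emeasurable_funD.
- by move=> x x0; apply: adde_ge0; exact: J0.
apply: eq_integral => x; rewrite inE/= => x0.
have fE c y : fading_laplace n Pt A t c y =
    (1 + k%:R * (q * c / (G * G)) * T * y / n.+1%:R) `^ (- n.+1%:R).
  by rewrite /fading_laplace tE; congr ((1 + _) `^ _); ring.
(* The point [(x, 0)] lies at distance [x] from the origin. *)
have ux : ul x <= 1.
  have := @point_laplace_bounds R n Pt A G g alphaL alphaN theta t Pt0 A0 G0 g0 t0 beta beta0 theta0 theta1 (x, 0).
  rewrite /point_laplace /dist0/= expr0n addr0 sqrtr_sqr ger0_norm//.
  by case/andP.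
rewrite ger0_norm ?subr_ge0// -EFinD -!EFinM; congr (_%:E).
rewrite /ul /J /ring_loss /lo /mark_laplace -/p0 -/p1 -/p2 !fE.
(* The weights sum to 1; eliminating [p2] makes the goal a polynomial identity. *)
have p2E : p2 = 1 - p0 - p1.
  rewrite /p0 /p1 /p2; have := @pi_gt0 R; move: (@pi R) => z z0.
  by field; rewrite gt_eqF.
rewrite p2E; move: p0 p1 (@pi R) (lp beta x) => a b c l; ring.
Qed.

End kappa.

(** * Coverage probability *)

Lemma one_sub_expr_one_sub {R : realType} (N : nat) (z : R) :
  1 - (1 - z) ^+ N = \sum_(1 <= k < N.+1) 'C(N, k)%:R * (-1) ^+ k.+1 * z ^+ k.
Proof.
have -> : (1 - z) ^+ N = \sum_(0 <= k < N.+1) 'C(N, k)%:R * (-1) ^+ k * z ^+ k.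
  rewrite exprDn big_mkord; apply: eq_bigr => k _.
  by rewrite expr1n mul1r -mulr_natl -mulrA -exprMn mulN1r.
rewrite big_ltn// bin0 !expr0 !mulr1 opprD addrA subrr add0r -sumrN.
by apply: eq_bigr => k _; rewrite exprS; ring.
Qed.

(** The binomial coefficients will alternate in sign, so linearity needs integrability, here
    obtained from boundedness. *)
Lemma integral_bounded_sum {d} {T : measurableType d} {R : realType}
    (P : probability T R) (s : seq nat) (al l : nat -> R) (e : nat -> T -> R) :
  (forall k, measurable_fun setT (e k)) -> (forall k w, 0 <= e k w <= 1) ->
  (forall k, k \in s -> \int[P]_w (e k w)%:E = (l k)%:E)%E ->
  P.-integrable setT (fun w => (\sum_(k <- s) al k * e k w)%:E) /\
  (\int[P]_w (\sum_(k <- s) al k * e k w)%:E)%E = (\sum_(k <- s) al k * l k)%:E.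
Proof.
move=> me e01.
have ie k : P.-integrable setT (EFin \o e k).
  apply: (@le_integrable _ _ _ P _ measurableT _ (cst 1%E)).
  - exact/measurable_EFinP.
  - by move=> w _; rewrite /= normr1 lee_fin ger0_norm; case/andP: (e01 k w).
  - exact: finite_measure_integrable_cst.
elim: s => [|k s IH] le.
  rewrite big_nil; split.
    rewrite (_ : (fun w => _) = cst 0%E); first exact: integrable0.
    by apply/funext => w; rewrite big_nil.
  by under eq_integral do rewrite big_nil; rewrite integral0.
have [|i1 i2] := IH.
  by move=> j js; apply: le; rewrite inE js orbT.
have ik : P.-integrable setT (fun w => (al k)%:E * (e k w)%:E)%E.
  by have := integrableZl measurableT (al k) (ie k).
rewrite (_ : (fun w => (\sum_(j <- k :: s) al j * e j w)%:E) =
    (fun w => (al k)%:E * (e k w)%:E) \+ (fun w => (\sum_(j <- s) al j * e j w)%:E))%E; last first.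
  by apply/funext => w; rewrite big_cons EFinD EFinM.
split; first exact: integrableD.
have Ek : (\int[P]_w ((al k)%:E * (e k w)%:E) = (al k * l k)%:E)%E.
  apply: (etrans (integralZl measurableT (ie k) (al k))).
  by rewrite EFinM; congr (_ * _)%E; exact: (le k (mem_head _ _)).
by rewrite integralD//; rewrite i2 Ek big_cons EFinD.
Qed.

Section coverage.
Context {d} {Om : measurableType d} {R : realType} (P : probability Om R).
Variables (X : nat -> Om -> R * R) (L : nat -> set Om) (h Mt : nat -> Om -> R)
  (h0 : Om -> R) (L0 : set Om).
Hypothesis mX : forall k, measurable_fun setT (X k).
Hypothesis mL : forall k, measurable (L k).
Hypothesis mh : forall k, measurable_fun setT (h k).
Hypothesis mMt : forall k, measurable_fun setT (Mt k).
Hypothesis mh0 : measurable_fun setT h0.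
Hypothesis mL0 : measurable L0.
Hypothesis hindep : mutually_indep P (model_sigma X L h Mt h0 L0).
Notation OT s := (g_sigma_algebraType (others X L h Mt h0 L0 s)).
Variables (n : nat) (Pt A G g alphaL alphaN N0 c : R).
Hypotheses (n0 : (0 < n)%N) (Pt0 : 0 < Pt) (A0 : 0 < A) (G0 : 0 < G) (g0 : 0 < g)
  (N00 : 0 < N0) (c0 : 0 < c).
Hypothesis h_ge0 : forall k w, 0 <= h k w.
Hypothesis hh0 : has_gamma_law P n.+1 (n.+1%:R)^-1 h0.
Notation I := (interference Pt A G g alphaL alphaN X L h Mt).

Let term_ge0 k w : 0 <= Pt * gain G g (Mt k w) * h k w * A * pathloss X L alphaL alphaN k w.
Proof. by rewrite !mulr_ge0 ?(ltW Pt0) ?(ltW A0) ?gain_ge0 ?pathloss_ge0. Qed.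

Lemma interference_ge0 w : (0 <= I w)%E.
Proof. by apply: nneseries_ge0 => k _ _; rewrite lee_fin; exact: term_ge0. Qed.

Lemma others_interference s : sXL <> s -> (forall k, sH k <> s) -> (forall k, sM k <> s) ->
  measurable_fun setT (I : OT s -> \bar R).
Proof.
move=> s1 s2 s3.
apply: (@ge0_emeasurable_sum _ (OT s) R setT (fun k w =>
  (Pt * gain G g (Mt k w) * h k w * A * pathloss X L alphaL alphaN k w)%:E) xpredT).
  by move=> k w _ _; rewrite lee_fin.
move=> k _; apply/measurable_EFinP.
apply: measurable_funM; last exact: others_pathloss.
apply: measurable_funM => //; apply: measurable_funM; last by apply: (others_rv (s2 k)).
by apply: measurable_funM => //; exact: others_gain.
Qed.

Lemma measurable_interference : measurable_fun setT I.
Proof.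
apply: (@measurable_fun_others _ _ _ X L h Mt h0 L0 mX mL mh mMt mh0 mL0 _ _ sH0).
exact: others_interference.
Qed.

(** Coverage for a fixed state of the desired link, whose path loss enters only through [c]. *)
Definition threshold_event : set Om :=
  [set w | (c%:E * (N0%:E + I w) <= (h0 w)%:E)%E].

(** Probability of coverage given interference [y]; it is 0 at [+oo], where no fading is large
    enough. *)
Definition threshold_tail (y : \bar R) : R :=
  if y is r%:E then erlang_tail n.+1 (n.+1%:R * (c * (N0 + r))) else 0.

Lemma others_threshold_event : <<s others X L h Mt h0 L0 sL0 >> threshold_event.
Proof.
have mI : measurable_fun setT (I : OT sL0 -> \bar R) by exact: others_interference.
have mh0' : measurable_fun setT (h0 : OT sL0 -> R).
  by apply: (@others_rv _ _ _ X L h Mt h0 L0 _ _ sL0 sH0).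
have mE1 : measurable_fun setT ((fun w => c%:E * (N0%:E + I w))%E : OT sL0 -> \bar R).
  by apply: measurable_funeM; apply: emeasurable_funD.
have mE2 : measurable_fun setT ((fun w => (h0 w)%:E) : OT sL0 -> \bar R).
  exact/measurable_EFinP.
have := @measurable_lee _ (OT sL0) R setT measurableT _ _ mE1 mE2.
by rewrite setTI.
Qed.

Lemma measurable_threshold_event : measurable threshold_event.
Proof.
apply: (@others_measurable _ _ _ X L h Mt h0 L0 mX mL mh mMt mh0 mL0 sL0).
exact: others_threshold_event.
Qed.

Lemma threshold_event_indep E : sigma_ev L0 E ->
  P (E `&` threshold_event) = (P E * P threshold_event)%E.
Proof.
move=> LE; apply: (@indep_others _ _ _ P X L h Mt h0 L0 mX mL mh mMt mh0 mL0 hindep sL0) => //.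
exact: others_threshold_event.
Qed.

(** The desired fading is independent of the interference, so it can be integrated out with the
    interference frozen. *)
Lemma threshold_eventE : P threshold_event = (\int[P]_w (threshold_tail (I w))%:E)%E.
Proof.
pose S : set (R * \bar R) := [set z | (c%:E * (N0%:E + z.2) <= z.1%:E)%E].
have mS : measurable S.
  have mE1 : measurable_fun setT (fun z : R * \bar R => c%:E * (N0%:E + z.2))%E.
    apply: measurable_funeM; apply: emeasurable_funD => //; exact: measurable_snd.
  have mE2 : measurable_fun setT (fun z : R * \bar R => z.1%:E).
    by apply/measurable_EFinP; exact: measurable_fst.
  by have := measurable_lee measurableT mE1 mE2; rewrite setTI.
pose f (z : R * \bar R) : \bar R := (\1_S z)%:E.
have mf : measurable_fun setT f by apply/measurable_EFinP; exact: measurable_indic.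
have f0 z : (0 <= f z)%E by rewrite lee_fin.
have mI : measurable_fun setT (I : OT sH0 -> \bar R) by exact: others_interference.
have F := @fubini_others _ _ _ P X L h Mt h0 L0 mX mL mh mMt mh0 mL0 hindep _ _ _ _
  sH0 h0 I f (fun _ => id) mI mf f0.
transitivity (\int[P]_w f (h0 w, I w))%E.
  transitivity (\int[P]_w (\1_threshold_event w)%:E)%E.
    by rewrite integral_indic ?setIT//; exact: measurable_threshold_event.
  by apply: eq_integral => w _; rewrite /f !indicE; congr (_%:R%:E).
rewrite F; apply: eq_integral => w _.
have Iw := interference_ge0 w.
have mset y : measurable [set w' | S (h0 w', y)].
  have := measurable_fun_pair mh0 (@measurable_cst _ _ Om _ setT y) measurableT mS.
  by rewrite setTI.
transitivity (P [set w' | S (h0 w', I w)]).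
  transitivity (\int[P]_w' (\1_[set w' | S (h0 w', I w)] w')%:E)%E.
    by apply: eq_integral => w' _; rewrite /f !indicE; congr (_%:R%:E).
  by rewrite integral_indic ?setIT.
move: Iw; case: (I w) => [r| |]// r0.
- rewrite lee_fin in r0; rewrite /= -(gamma_law_tail hh0 n0); last first.
    by rewrite mulr_ge0 ?(ltW c0)// addr_ge0// ltW.
  by congr (P _); apply/seteqP; split => w' /=; rewrite /S/= -EFinD -EFinM lee_fin.
- rewrite (_ : [set _ | _] = set0) ?measure0//.
  apply/seteqP; split => // w' /=; rewrite /S/= addey// gt0_muley ?lte_fin//.
Qed.

Lemma threshold_tail_ge0 w : 0 <= threshold_tail (I w).
Proof.
have := interference_ge0 w; case: (I w) => [r| |]//= r0; rewrite lee_fin in r0.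
by rewrite erlang_tail_ge0// mulr_ge0// mulr_ge0 ?(ltW c0)// addr_ge0// ltW.
Qed.

Lemma measurable_threshold_tail : measurable_fun setT threshold_tail.
Proof.
rewrite (_ : threshold_tail =
    fine \o er_map (fun r => erlang_tail n.+1 (n.+1%:R * (c * (N0 + r))))); last first.
  by apply/funext => -[].
apply: measurableT_comp; first exact: fine_measurable.
apply: (@measurable_er_map _ (measurableTypeR R)).
apply: (measurableT_comp (continuous_measurable_fun (@continuous_erlang_tail R n))).
apply: measurable_funM => //; apply: measurable_funM => //.
exact: (@measurable_funD _ _ R setT (cst N0) id).
Qed.

(** Alzer's exponent times the rate [n.+1] of the desired fading. *)
Let a : R := n.+1%:R * n.+1`!%:R `^ (- n.+1%:R^-1).
Let tk (k : nat) : R := k%:R * a * c.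

Let a_gt0 : 0 < a.
Proof. by rewrite mulr_gt0// powR_gt0// ltr0n fact_gt0. Qed.

Definition threshold_bound (y : \bar R) : R :=
  \sum_(1 <= k < n.+2) 'C(n.+1, k)%:R * (-1) ^+ k.+1 * expR (- (tk k * N0)) *
    expN ((tk k)%:E * y)%E.

(** The binomial sum starts at [k = 1], so every term carries a vanishing exponential, in agreement
    with [threshold_tail]. *)
Lemma threshold_bound_oo : threshold_bound +oo%E = 0.
Proof.
rewrite /threshold_bound big_nat big1// => k /andP[k1 _].
by rewrite gt0_muley ?mulr0// lte_fin !mulr_gt0// ltr0n.
Qed.

Lemma threshold_tail_lt_bound (r : R) : 0 <= r ->
  threshold_tail r%:E < threshold_bound r%:E.
Proof.
move=> r0; set x := c * (N0 + r).
have x0 : 0 < x by rewrite mulr_gt0// ltr_pwDl.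
have := @alzer R n (n.+1%:R * x) n0 (mulr_gt0 (ltr0Sn _ n) x0).
have -> : n.+1`!%:R `^ (- n.+1%:R^-1) * (n.+1%:R * x) = a * x by rewrite /a; ring.
rewrite /= -/x => az.
suff -> : threshold_bound r%:E = 1 - (1 - expR (- (a * x))) ^+ n.+1 by lra.
rewrite one_sub_expr_one_sub; apply: eq_bigr => k _.
rewrite -mulrA; congr (_ * _); rewrite -expRD -expRM_natl; congr (expR _).
by rewrite /tk /x; ring.
Qed.

Variable l : nat -> R.
Hypothesis lE : forall k, (1 <= k < n.+2)%N ->
  (\int[P]_w (expN ((tk k)%:E * I w)%E)%:E)%E = (l k)%:E.
Hypothesis l1 : 0 < l 1.

(** The gap [u] between bound and tail is nonnegative, and zero only where the interference is
    infinite. If its integral were 0, the interference would be infinite almost surely and its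
    Laplace transform at [tk 1] would be 0, against [l1]. *)
Lemma threshold_event_lt : (P threshold_event <
  (\sum_(1 <= k < n.+2) 'C(n.+1, k)%:R * (-1) ^+ k.+1 * expR (- (tk k * N0)) * l k)%:E)%E.
Proof.
have mI := measurable_interference.
have tk0 k : 0 <= tk k by rewrite !mulr_ge0// ltW.
have me k : measurable_fun setT (fun w => expN ((tk k)%:E * I w)%E).
  by apply: (measurableT_comp measurable_expN); exact: measurable_funeM.
have e01 k w : 0 <= expN ((tk k)%:E * I w)%E <= 1.
  by rewrite expN_ge0 expN_le1// mule_ge0 ?lee_fin// interference_ge0.
have lE' k : k \in index_iota 1 n.+2 ->
    (\int[P]_w (expN ((tk k)%:E * I w)%E)%:E)%E = (l k)%:E.
  by rewrite mem_index_iota; exact: lE.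
have [_ BE] := integral_bounded_sum
  (fun k => 'C(n.+1, k)%:R * (-1) ^+ k.+1 * expR (- (tk k * N0))) me e01 lE'.
rewrite -BE threshold_eventE.
pose u w := threshold_bound (I w) - threshold_tail (I w).
have u_case w : (I w = +oo%E /\ u w = 0) \/ 0 < u w.
  have := interference_ge0 w; rewrite /u; case: (I w) => [r| |]// r0.
    by right; rewrite subr_gt0 threshold_tail_lt_bound.
  by left; rewrite threshold_bound_oo subr0.
have u0 w : 0 <= u w by case: (u_case w) => [[_ ->]|/ltW].
have mb : measurable_fun setT (fun w => threshold_bound (I w)).
  by apply: measurable_sum => k; apply: measurable_funM.
have mt : measurable_fun setT (fun w => threshold_tail (I w)).
  exact: (measurableT_comp measurable_threshold_tail).
have mu : measurable_fun setT u by exact: measurable_funB.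
(* Writing the bound as tail plus gap leaves only integrals of nonnegative functions, and reduces
   strictness to a positive integral of [u]. *)
have -> : (\int[P]_w (\sum_(k <- index_iota 1 n.+2) 'C(n.+1, k)%:R * (-1) ^+ k.+1 *
    expR (- (tk k * N0)) * expN ((tk k)%:E * I w)%E)%:E =
    \int[P]_w (threshold_tail (I w))%:E + \int[P]_w (u w)%:E)%E.
  rewrite -ge0_integralD//.
  - by apply: eq_integral => w _; rewrite -EFinD /u addrC subrK.
  - by move=> w _; rewrite lee_fin threshold_tail_ge0.
  - exact/measurable_EFinP.
  - by move=> w _; rewrite lee_fin.
  - exact/measurable_EFinP.
rewrite lteDl; last first.
  rewrite -threshold_eventE fin_num_measure//; exact: measurable_threshold_event.
rewrite lt_neqAle integral_ge0 ?andbT; last by move=> w _; rewrite lee_fin.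
apply/negP => /eqP/esym iu0.
have muE : measurable_fun setT (fun w => (u w)%:E) by exact/measurable_EFinP.
have uae : ae_eq P setT (fun w => (u w)%:E) (cst 0%E).
  apply/(ae_eq_integral_abs P measurableT muE); rewrite -[RHS]iu0.
  by apply: eq_integral => w _; rewrite /= ger0_norm.
have : (\int[P]_w (expN ((tk 1)%:E * I w)%E)%:E = 0)%E.
  rewrite (@ae_eq_integral _ _ _ P setT (cst 0%E) (fun w => (expN ((tk 1)%:E * I w)%E)%:E))//.
  - exact: integral0.
  - exact/measurable_EFinP.
  - apply: filterS uae => w /(_ Logic.I) [uw] _.
    case: (u_case w) => [[-> _]|]; last by rewrite uw ltxx.
    by rewrite gt0_muley ?lte_fin// !mulr_gt0.
rewrite lE// => -[l10]; by move: l1; rewrite l10 ltxx.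
Qed.

End coverage.

(** The case [y = +oo], where both inequalities fail, covers infinite interference. *)
Lemma lee_pdivr_mul {R : realType} (T B x : R) (y : \bar R) : 0 < T -> 0 < B ->
  (0 <= y)%E -> (T%:E * y <= (B * x)%:E)%E = ((T / B)%:E * y <= x%:E)%E.
Proof.
move=> T0 B0; case: y => [r| |]// _.
  by rewrite -!EFinM !lee_fin mulrAC ler_pdivrMr// [x * _]mulrC.
by rewrite !gt0_muley ?lte_fin ?divr_gt0.
Qed.

(** * Combination of the two states of the desired link *)

Unset Implicit Arguments.
Set Strict Implicit.

Theorem theorem1 (R : realType) (d : measure_display) (Om : measurableType d)
  (P : probability Om R)
  (lam r Pt A N0 alphaL alphaN beta G g theta : R) (Nh : nat)
  (hlam : 0 < lam) (hr : 0 < r) (hPt : 0 < Pt) (hA : 0 < A) (hN0 : 0 < N0)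
  (haL : 0 < alphaL) (haN : 0 < alphaN) (hbeta : 0 < beta) (hNh : (2 <= Nh)%N)
  (hG : 0 < G) (hg : 0 < g) (htheta0 : 0 < theta) (htheta1 : theta <= pi)
  (X : nat -> Om -> R * R) (L : nat -> set Om) (h Mt : nat -> Om -> R)
  (h0 : Om -> R) (L0 : set Om)
  (hX : is_PPP P lam X)
  (hL : los_marks P beta X L)
  (hh : forall k, has_gamma_law P Nh (Nh%:R)^-1 (h k))
  (hh_nonneg : forall k w, 0 <= h k w)
  (hh0 : has_gamma_law P Nh (Nh%:R)^-1 h0)
  (hM : forall k, measurable_fun setT (Mt k) /\
     P (Mt k @^-1` [set 0]) = ((theta / pi) ^+ 2)%:E /\
     P (Mt k @^-1` [set 1]) = (2 * (theta / pi) * ((pi - theta) / pi))%:E /\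
     P (Mt k @^-1` [set 2]) = (((pi - theta) / pi) ^+ 2)%:E)
  (hL0 : measurable L0 /\ P L0 = (lp beta r)%:E)
  (hindep : mutually_indep P (fun s => match s with
     | sXL => <<s (\bigcup_k sigma_rv (X k)) `|` (\bigcup_k sigma_ev (L k)) >>
     | sH0 => sigma_rv h0
     | sL0 => sigma_ev L0
     | sH k => sigma_rv (h k)
     | sM k => sigma_rv (Mt k) end))
  (T : R) (hT : 0 < T) :
  let a := Nh%:R * powR (Nh`!%:R) (- (Nh%:R)^-1) in
  let G0 := G * G in
  let KL := a * powR r alphaL / (Pt * G0 * A) in
  let KN := a * powR r alphaN / (Pt * G0 * A) in
  let kappaL n := kap Nh G g theta (a * powR r alphaL) alphaL beta true n T in
  let kappaN n := kap Nh G g theta (a * powR r alphaL) alphaN beta false n T in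
  let xiL n := kap Nh G g theta (a * powR r alphaN) alphaL beta true n T in
  let xiN n := kap Nh G g theta (a * powR r alphaN) alphaN beta false n T in
  (* the quantities kappa_L, kappa_N, xi_L, xi_N are (finite) real numbers *)
  (forall n, (1 <= n <= Nh)%N ->
     [/\ (kappaL n < +oo)%E, (kappaN n < +oo)%E, (xiL n < +oo)%E & (xiN n < +oo)%E]) ->
  (P (coverage_event Pt A N0 G g r alphaL alphaN T X L h Mt h0 L0)
   < ((\sum_(1 <= n < Nh.+1)
         'C(Nh, n)%:R * (-1) ^+ n.+1 * expR (- (n%:R * KL * T * N0)) *
         expR (- (2 * pi * lam * (fine (kappaL n) + fine (kappaN n)))) * lp beta r)
      + (\sum_(1 <= n < Nh.+1)
         'C(Nh, n)%:R * (-1) ^+ n.+1 * expR (- (n%:R * KN * T * N0)) *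
         expR (- (2 * pi * lam * (fine (xiL n) + fine (xiN n)))) * (1 - lp beta r)))%:E)%E.
Proof.
case: Nh hNh hh hh0 => [//|n] hNh hh hh0.
move=> a G0 KL KN kappaL kappaN xiL xiN kfin.
have n0 : (0 < n)%N by [].
have mX := hX.1; have mL := hL.1.
have mh k := (hh k).1; have mMt k := (hM k).1; have hM' k := (hM k).2.
have mh0 := hh0.1; have [mL0 PL0] := hL0.
have indep : mutually_indep P (model_sigma X L h Mt h0 L0) by exact: hindep.
have a0 : 0 < a by rewrite mulr_gt0// powR_gt0// ltr0n fact_gt0.
pose q al := a * r `^ al.
have q0 al : 0 <= q al by rewrite mulr_ge0 ?powR_ge0// ltW.
(* With exponent [al] the signal is [B al * h0], so coverage reads [h0 >= cc al * (N0 + I)]. *)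
pose B al := Pt * (G * G) * A * r `^ (- al).
have B0 al : 0 < B al by rewrite !mulr_gt0// powR_gt0.
pose cc al := T / B al.
have cc0 al : 0 < cc al by rewrite divr_gt0.
(* The Laplace point [k * a * cc al] equals [k * K * T], where [K] is [KL] or [KN] according to
   [al]. *)
have acE al (k : nat) : k%:R * a * cc al = k%:R * (q al / (Pt * (G * G) * A)) * T.
  rewrite /cc /B /q powRN.
  have r0 : r `^ al != 0 by rewrite gt_eqF// powR_gt0.
  by field; rewrite r0 !gt_eqF.
pose thr al := threshold_event X L h Mt h0 Pt A G g alphaL alphaN N0 (cc al).
pose kL al k := kap n.+1 G g theta (q al) alphaL beta true k T.
pose kN al k := kap n.+1 G g theta (q al) alphaN beta false k T.
pose S al := \sum_(1 <= k < n.+2) 'C(n.+1, k)%:R * (-1) ^+ k.+1 *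
  expR (- (k%:R * (q al / (Pt * (G * G) * A)) * T * N0)) *
  expR (- (2 * pi * lam * (fine (kL al k) + fine (kN al k)))).
(* One argument serves both states: [al = alphaL] yields the kappa integrals and [al = alphaN] the
   xi integrals. *)
have key al : (forall k, (1 <= k < n.+2)%N -> (kL al k < +oo)%E /\ (kN al k < +oo)%E) ->
    (P (thr al) < (S al)%:E)%E.
  move=> kfin'.
  have lE k : (1 <= k < n.+2)%N ->
      (\int[P]_w (expN ((k%:R * a * cc al)%:E *
        interference Pt A G g alphaL alphaN X L h Mt w)%E)%:E)%E =
      (expR (- (2 * pi * lam * (fine (kL al k) + fine (kN al k)))))%:E.
    move=> k1; have [kLoo kNoo] := kfin' k k1.
    have t0 : 0 < k%:R * a * cc al.
      have k0 : 0 < k%:R :> R by rewrite ltr0n; case/andP: k1.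
      by apply: mulr_gt0 => //; exact: mulr_gt0.
    have tE : k%:R * a * cc al * Pt * A = k%:R * (q al / (G * G)) * T.
      by rewrite acE; field; rewrite !gt_eqF.
    have kLfin : kL al k \is a fin_num by rewrite ge0_fin_numE// kap_ge0.
    have kNfin : kN al k \is a fin_num by rewrite ge0_fin_numE// kap_ge0.
    have IE := integral_point_laplace n hG hg hbeta htheta0 htheta1 hT alphaL alphaN hPt hA t0 (q0 al) tE.
    rewrite -/(kL al k) -/(kN al k) in IE.
    rewrite (interference_laplace mX mL mh mMt mh0 mL0 indep n0 hPt hA hG hg t0 hh
      hh_nonneg hM' hbeta hlam htheta0 htheta1 hX hL).
      rewrite IE; congr (expR (- _))%:E.
      have -> : (kL al k + kN al k)%E = (fine (kL al k) + fine (kN al k))%:E.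
        by rewrite EFinD !fineK.
      by rewrite -EFinM /=; ring.
    by rewrite IE -(fineK kLfin) -(fineK kNfin) -EFinD -EFinM ltry.
  have l1 : 0 < expR (- (2 * pi * lam * (fine (kL al 1) + fine (kN al 1)))) by exact: expR_gt0.
  have := threshold_event_lt mX mL mh mMt mh0 mL0 indep n0 hPt hA hG hg hN0 (cc0 al) hh_nonneg hh0 lE l1.
  move=> /lt_le_trans; apply; rewrite lee_fin le_eqVlt; apply/orP; left; apply/eqP.
  by apply: eq_bigr => k _; rewrite acE.
have mthr al : measurable (thr al) by exact: measurable_threshold_event.
have covE : coverage_event Pt A N0 G g r alphaL alphaN T X L h Mt h0 L0 =
    (L0 `&` thr alphaL) `|` (~` L0 `&` thr alphaN).
  apply/seteqP; split => w; rewrite /coverage_event /signal /thr /threshold_event /=.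
    have Iw : (0 <= N0%:E + interference Pt A G g alphaL alphaN X L h Mt w)%E.
      by rewrite adde_ge0 ?lee_fin ?(ltW hN0)// interference_ge0.
    case: asboolP => Lw; [move=> H; left|move=> H; right]; split => //=;
      by rewrite -lee_pdivr_mul//; move: H; congr (is_true (_ <= _%:E)%E); rewrite /B; ring.
  have Iw : (0 <= N0%:E + interference Pt A G g alphaL alphaN X L h Mt w)%E.
    by rewrite adde_ge0 ?lee_fin ?(ltW hN0)// interference_ge0.
  case: asboolP => Lw [] [] //= _;
    by rewrite -lee_pdivr_mul//; congr (is_true (_ <= _%:E)%E); rewrite /B; ring.
have indE E al : sigma_ev L0 E -> P (E `&` thr al) = (fine (P E) * fine (P (thr al)))%:E.
  move=> LE.
  apply: (etrans (@threshold_event_indep _ _ _ P X L h Mt h0 L0 mX mL mh mMt mh0 mL0 indep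
    Pt A G g alphaL alphaN N0 (cc al) hPt hA hG hg hh_nonneg E LE)).
  have mE : measurable E by exact: (sigma_ev_measurable mL0).
  by rewrite EFinM !fineK// fin_num_measure.
have lpE : fine (P L0) = lp beta r by rewrite PL0.
have lpE' : fine (P (~` L0)) = 1 - lp beta r.
  by rewrite probability_setC// PL0 -EFinB.
have ltS al : (P (thr al) < (S al)%:E)%E -> fine (P (thr al)) < S al.
  by move=> H; rewrite -lte_fin fineK// fin_num_measure.
have lt_L : fine (P (thr alphaL)) < S alphaL.
  by apply: ltS; apply: key => k k1; have [HL HN _ _] := kfin k k1; split; [exact: HL|exact: HN].
have lt_N : fine (P (thr alphaN)) < S alphaN.
  by apply: ltS; apply: key => k k1; have [_ _ HL HN] := kfin k k1; split; [exact: HL|exact: HN].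
clear key; clearbody thr.
have lp0 : 0 < lp beta r by exact: expR_gt0.
have lp1 : 0 <= 1 - lp beta r by rewrite subr_ge0 lp_le1// ltW.
have PE : P (coverage_event Pt A N0 G g r alphaL alphaN T X L h Mt h0 L0) =
    (lp beta r * fine (P (thr alphaL)) + (1 - lp beta r) * fine (P (thr alphaN)))%:E.
  have m1 : measurable (L0 `&` thr alphaL) by exact: measurableI.
  have m2 : measurable (~` L0 `&` thr alphaN).
    by apply: measurableI => //; exact: measurableC.
  have dis : (L0 `&` thr alphaL) `&` (~` L0 `&` thr alphaN) = set0.
    by rewrite setIACA setICr set0I.
  have eL : P (L0 `&` thr alphaL) = (lp beta r * fine (P (thr alphaL)))%:E.
    by rewrite -lpE; apply: indE; right; left.
  have eN : P (~` L0 `&` thr alphaN) = ((1 - lp beta r) * fine (P (thr alphaN)))%:E.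
    by rewrite -lpE'; apply: indE; right; right; left.
  rewrite covE; apply: (etrans (measureU P m1 m2 dis)).
  by rewrite EFinD; congr (_ + _)%E; [exact: eL|exact: eN].
rewrite PE -!mulr_suml lte_fin.
(* Strictness is drawn from the line-of-sight term, whose weight [lp beta r] is positive; the other
   weight is only known to be nonnegative. *)
apply: ltr_leD.
  by rewrite [ltLHS]mulrC (ltr_pM2r lp0); exact: lt_L.
by rewrite [leLHS]mulrC; apply: (ler_wpM2r lp1); apply: ltW; exact: lt_N.
Unshelve. exact: 0%N. Qed.
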